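(* For every integer $s \ge 2$ there exists $n_0 = n_0(s)$ such that the following holds for every $n \ge n_0$. Let $(G,c)$ be an $n$-vertex edge-colored graph with $\delta^c(G) \ge \left(1 - \frac{1}{s-1}\right)n$ that contains no rainbow $K_s$. Then $s-1$ divides $n$, $G$ is a complete balanced $(s-1)$-partite graph (that is, all $s-1$ parts have the same size $n/(s-1)$), and $c$ is a proper edge-coloring of $G$.
   Context: An $n$-vertex edge-colored graph $(G,c)$ consists of a finite simple $n$-vertex graph $G=(V,E)$ and an arbitrary function $c : E \to \mathbb{N}$ (not necessarily a proper coloring). A subgraph $H \subseteq G$ is rainbow if $c$ is injective on $E(H)$. The coloring $c$ is proper if for every vertex $v$ the edges incident to $v$ have pairwise distinct colors. The color degree $d^c_G(v)$ of $v \in V$ is the number of distinct colors appearing on edges incident to $v$, and $\delta^c(G) = \min\{ d^c_G(v) : v \in V\}$. *)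

(* Defs.v *)
From HB Require Import structures.
From mathcomp Require Import all_boot all_order all_algebra.

Set Implicit Arguments.
Unset Strict Implicit.
Unset Printing Implicit Defensive.

Record sgraph (T : finType) := SGraph {
  adj :> rel T;
  adj_sym : symmetric adj;
  adj_irrefl : irreflexive adj
}.

Definition edge_set (T : finType) (G : sgraph T) : {set {set T}} :=
  [set [set xy.1; xy.2] | xy in [set xy : T * T | G xy.1 xy.2]].

Definition edge (T : finType) (G : sgraph T) := {e : {set T} | e \in edge_set G}.

Definition coloring (T : finType) (G : sgraph T) := edge G -> nat.

Definition rainbow (T : finType) (G : sgraph T) (c : coloring G)
  (F : {set edge G}) : Prop := {in F &, injective c}.

(* A copy of K_s in G is determined by its s vertices: its edges are all the
   edges of G inside this set. *)
Definition has_rainbow_clique (T : finType) (G : sgraph T) (c : coloring G)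
  (s : nat) : Prop :=
  exists S : {set T},
    [/\ #|S| = s,
        {in S &, forall x y, x != y -> G x y}
      & rainbow c [set e : edge G | val e \subset S]].

Definition proper_coloring (T : finType) (G : sgraph T) (c : coloring G) : Prop :=
  forall (v : T) (e f : edge G),
    v \in val e -> v \in val f -> e != f -> c e != c f.

Definition color_degree (T : finType) (G : sgraph T) (c : coloring G) (v : T) : nat :=
  size (undup [seq c e | e in [set e : edge G | v \in val e]]).

(* Every color degree is smaller than #|T|, so the default value #|T| does not
   affect the minimum when T is nonempty. *)
Definition min_color_degree (T : finType) (G : sgraph T) (c : coloring G) : nat :=
  \big[minn/#|T|]_(v : T) color_degree c v.

(* f maps each vertex to the index of its part. *)
Definition complete_balanced_partite (T : finType) (G : sgraph T) (r : nat) : Prop :=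
  exists f : T -> 'I_r,
    (forall i : 'I_r, #|[set x | f x == i]| = #|T| %/ r) /\
    (forall x y : T, G x y = (f x != f y)).

(* Main.v *)
Require Import Defs.
From HB Require Import structures.
From mathcomp Require Import all_boot all_order all_algebra.
From mathcomp Require Import zify ring.
Import Order.TTheory GRing.Theory Num.Theory.

Set Implicit Arguments.
Unset Strict Implicit.
Unset Printing Implicit Defensive.

(** Write r = s - 1 and let n be the number of vertices. Every vertex x keeps one
    neighbour for each colour that it sees; x -> y means that y is kept by x. Each
    vertex then has at most n/r non-out-neighbours, itself included, and the
    arcs out of one vertex have distinct colours.

    Call a pair one-way if only one of its two arcs is present. Two edges xy, xz of
    the same colour cannot both have the arc out of x. So, up to coincidences in
    which one vertex is determined by the others, a clique of the digraph is
    rainbow as soon as no vertex receives two one-way arcs. The coincidences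
    are sparse, and are avoided by working inside a hereditary family of
    free sets, each of which extends by all but a tiny fraction of the vertices
    ([free_system], [rainbow_admissible]).

    Price a pair of vertices by the number 0, 1 or 2 of its missing arcs. In a
    free set of least energy no vertex is more expensive than an average
    vertex outside would be. Hence a vertex set with energy clearly below the value
    2/r per pair would contain a free set of r + 1 vertices whose one-way
    pairs form a matching, which is a rainbow clique
    ([energy_lower_bound]). Used for all vertices and for all but a few, this forces
    almost every vertex to miss about n/r arcs in each direction
    ([regular_set]).

    Now let Q be a free set of r vertices of least energy. Every further vertex
    misses at least two arcs to Q, and two is the average, so almost all miss
    exactly two; an exchange that keeps the energy therefore replaces a vertex of
    Q by a twin of it ([minfree_twin]). If b in Q lay in a one-way pair of Q, the
    vertices in one-way position to b would form an almost regular tournament on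
    about 2n/r vertices. A cyclic triangle of that tournament can replace two
    vertices of Q, and yields a rainbow clique on r + 1 vertices
    ([no_matched_pair]). So Q is bidirected, and the sets of
    non-neighbours of its vertices almost partition the graph
    ([almost_partite_of_bidirected]).

    To make this exact, put each vertex into a part to which it sends few arcs. Let
    I count the arcs inside parts and M the missing arcs between parts. Counting all
    arcs gives M <= I by the Cauchy-Schwarz inequality. If uv is an edge inside a
    part, then in some other part most vertices w see u and v in the same colour,
    for otherwise uv extends to a rainbow clique; such a w misses the arc to u
    or to v. A missing arc is blamed by few edges uv, so I is much smaller than M
    unless both vanish. Then the parts have equal size, and all edges between them
    are present and kept at both ends, which means that the colouring is proper
    ([partite_of_near_partite]). *)

(** * Free sets: avoiding sparse coincidences *)

Definition ext_deg (T : finType) (H : {set {set T}}) (A : {set T}) : nat :=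
  #|[set v | (v \notin A) && (v |: A \in H)]|.

Lemma ext_degU (T : finType) (H1 H2 : {set {set T}}) (A : {set T}) :
  ext_deg (H1 :|: H2) A <= ext_deg H1 A + ext_deg H2 A.
Proof.
rewrite /ext_deg; apply: leq_trans (leq_card_setU _ _); apply: subset_leq_card.
by apply/subsetP=> v; rewrite !inE; case: (v \in A).
Qed.

(** The map sending (A, v) to (v |: A, v) is injective, since A is recovered by
    deleting v. *)
Lemma ext_deg_double_count (T : finType) (H D : {set {set T}}) (k : nat) :
  (forall A, A \in D -> #|A| = k) ->
  \sum_(A in D) ext_deg H A <= k.+1 * #|[set X in H | #|X| == k.+1]|.
Proof.
move=> Dk; set Hk := [set X in H | _].
have -> : k.+1 * #|Hk| = \sum_(X in Hk) #|X|.
  rewrite mulnC -sum_nat_const; apply: eq_bigr => X.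
  by rewrite inE => /andP[_ /eqP].
pose P1 := [set p : {set T} * T | (p.1 \in D) && ((p.2 \notin p.1) && (p.2 |: p.1 \in H))].
pose P2 := [set p : {set T} * T | (p.1 \in Hk) && (p.2 \in p.1)].
have -> : \sum_(A in D) ext_deg H A = #|P1|.
  rewrite -sum1_card (eq_bigl _ _ (fun p => in_set _ p)) -(pair_big_dep (fun A => A \in D) (fun A v => (v \notin A) && (v |: A \in H)) (fun _ _ => 1)) /=.
  by apply: eq_bigr => A _; rewrite sum1_card /ext_deg cardsE.
have -> : \sum_(X in Hk) #|X| = #|P2|.
  rewrite -[RHS]sum1_card [RHS](eq_bigl _ _ (fun p => in_set _ p)) -(pair_big_dep (fun A => A \in Hk) (fun A v => v \in (A : {set T})) (fun _ _ => 1)) /=.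
  by apply: eq_bigr => A _; rewrite sum1_card.
pose phi (p : {set T} * T) := (p.2 |: p.1, p.2).
rewrite -(@card_in_imset _ _ phi); last first.
  move=> [A v] [B w]; rewrite !inE /= => /andP[_ /andP[vA _]] /andP[_ /andP[wB _]] [E vw].
  rewrite -vw in E wB *; congr (_, _); apply/setP=> x; move/setP/(_ x): E; rewrite !inE.
  by case: eqP => [->|//]; rewrite (negPf vA) (negPf wB).
apply: subset_leq_card; apply/subsetP=> q /imsetP[[A v]]; rewrite !inE /= => /and3P[AD vA vH] ->.
by rewrite !inE /= vH cardsU1 vA (Dk _ AD) add1n !eqxx.
Qed.

(** A sparse family of forbidden sets may contain a set with very many forbidden
    one-point extensions. Forbidding such sets as well, from the largest
    size downwards, keeps every level sparse because each of them uses up a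
    positive proportion of #|T| members of the level above. The sparsity bound at
    size 0 keeps the empty set allowed when #|T| is large. *)
Lemma sparse_closure (L k : nat) : forall K, exists n0, forall (T : finType) (H : {set {set T}}),
  n0 <= #|T| -> (forall X, X \in H -> #|X| <= k) ->
  (forall j, #|[set X in H | #|X| == j]| * #|T| <= K * #|T| ^ j) ->
  exists H' : {set {set T}},
    [/\ H \subset H', set0 \notin H' & forall A, A \notin H' -> L * ext_deg H' A <= k * #|T|].
Proof.
elim: k => [|k IH] K.
  exists K.+1 => T H nK Hk Hc; exists set0.
  have H0 : H = set0.
    apply/eqP; rewrite -subset0; apply/subsetP=> X XH.
    have := Hc 0; rewrite expn0 muln1.
    have : 0 < #|[set X in H | #|X| == 0]|.
      by apply/card_gt0P; exists X; rewrite inE XH -leqn0 Hk.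
    nia.
  split; rewrite ?H0 ?inE // => A _; rewrite /ext_deg.
  have -> : [set v | (v \notin A) && (v |: A \in set0)] = set0 by apply/setP=> v; rewrite !inE andbF.
  by rewrite cards0 muln0.
have [n0 Hn0] := IH (K + L * k.+1 * K).
exists (maxn n0 1) => T H nn Hk Hc.
have n_gt0 : 0 < #|T| by lia.
pose Hk1 := [set X in H | #|X| == k.+1].
(* The sets of size k that have to be forbidden because of level k.+1. *)
pose D := [set A : {set T} | (#|A| == k) && (#|T| < L * ext_deg H A)].
have Dcard : #|D| * #|T| <= L * k.+1 * K * #|T| ^ k.
  have h1 : \sum_(A in D) ext_deg H A <= k.+1 * #|Hk1|.
    by apply: ext_deg_double_count => A; rewrite inE => /andP[/eqP].
  have h2 : #|D| * #|T| <= L * \sum_(A in D) ext_deg H A.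
    rewrite big_distrr /= -sum_nat_const; apply: leq_sum => A.
    by rewrite inE => /andP[_ /ltnW].
  have h3 := Hc k.+1; rewrite -/Hk1 expnS in h3.
  rewrite -(leq_pmul2r n_gt0).
  have h4 : L * (k.+1 * #|Hk1|) * #|T| <= L * k.+1 * (K * (#|T| * #|T| ^ k)).
    by rewrite -!mulnA leq_mul2l leq_mul2l h3 !orbT.
  apply: leq_trans (leq_trans h4 _); last by nia.
  by rewrite leq_mul2r (leq_trans h2) ?orbT // leq_mul2l h1 orbT.
pose H1 := [set X in H | #|X| <= k] :|: D.
have [|||H' [sH' H'0 H'd]] := Hn0 T H1; first by lia.
- by move=> X; rewrite !inE => /orP[/andP[]|/andP[/eqP->]].
- move=> j.
  have sub : [set X in H1 | #|X| == j] \subset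
     [set X in H | #|X| == j] :|: (if j == k then D else set0).
    apply/subsetP=> X; rewrite !inE => /andP[/orP[/andP[XH _]|/andP[kX h]] jX].
      by rewrite XH jX.
    by rewrite -(eqP jX) (eqP kX) eqxx !inE kX h orbT.
  have h := leq_trans (subset_leq_card sub) (leq_card_setU _ _).
  rewrite mulnDl; apply: leq_trans (leq_mul h (leqnn _)) _; rewrite mulnDl.
  apply: leq_add; first exact: Hc.
  by case: eqP => [->//|_]; rewrite cards0.
exists (H' :|: Hk1); split.
- apply/subsetP=> X XH; rewrite inE; have := Hk _ XH; rewrite leq_eqVlt => /orP[h|h].
    by rewrite inE XH h orbT.
  by rewrite (subsetP sH') // !inE XH -ltnS h.
- by rewrite inE negb_or H'0 !inE cards0 andbF.
move=> A; rewrite inE negb_or => /andP[AH' _].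
have h1 := H'd _ AH'.
have h2 : L * ext_deg Hk1 A <= #|T|.
  have [kA|kA] := eqVneq #|A| k.
    have : A \notin D by apply: contra AH' => AD; apply: (subsetP sH'); rewrite inE AD orbT.
    rewrite inE kA eqxx /= -leqNgt; apply: leq_trans.
    rewrite leq_mul2l; apply/orP; right; apply: subset_leq_card.
    by apply/subsetP=> v; rewrite !inE => /andP[->] /andP[].
  rewrite /ext_deg (_ : [set v | _] = set0) ?cards0 ?muln0 //.
  by apply/setP=> v; rewrite !inE; case vA: (v \in A) => //=; rewrite cardsU1 vA add1n eqSS (negPf kA) andbF.
by have := ext_degU H' Hk1 A; nia.
Qed.

(** The arcs of a out of a vertex have pairwise distinct colours. *)
Definition representative (T : finType) (col : T -> T -> nat) (a : rel T) : Prop :=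
  forall x y z, a x y -> a x z -> col x y = col x z -> y = z.

(** The vertices whose presence next to B can repeat a colour of B: y is reached
    by an arc whose colour already occurs between two vertices of B. Since x keeps
    one vertex per colour, the triple (x, z, w) determines y, and there are
    only boundedly many such y. *)
Definition determined (T : finType) (col : T -> T -> nat) (a : rel T) (B : {set T}) : {set T} :=
  [set y | [exists x in B, exists z in B, exists w in B, a x y && (col x y == col z w)]].

Lemma determinedP (T : finType) (col : T -> T -> nat) (a : rel T) (B : {set T}) x y z w :
  x \in B -> z \in B -> w \in B -> a x y -> col x y = col z w -> y \in determined col a B.
Proof.
move=> xB zB wB axy /eqP e; rewrite inE; apply/exists_inP; exists x => //.
by apply/exists_inP; exists z => //; apply/exists_inP; exists w => //; rewrite axy.
Qed.

Lemma card_bigcup_leq (T I : finType) (A : {set I}) (F : I -> {set T}) (m : nat) :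
  (forall i, i \in A -> #|F i| <= m) -> #|\bigcup_(i in A) F i| <= #|A| * m.
Proof.
move=> Fm; rewrite -sum_nat_const.
apply: (@leq_trans (\sum_(i in A) #|F i|)); last exact: leq_sum.
elim/big_ind2: _ => [|m1 S1 m2 S2 h1 h2|//]; rewrite ?cards0 //.
by apply: leq_trans (leq_card_setU _ _) (leq_add _ _).
Qed.

Lemma card_determined (T : finType) (col : T -> T -> nat) (a : rel T) (B : {set T}) :
  representative col a -> #|determined col a B| <= #|B| ^ 3.
Proof.
move=> rep.
have sub : determined col a B \subset
   \bigcup_(x in B) \bigcup_(z in B) \bigcup_(w in B) [set y | a x y && (col x y == col z w)].
  apply/subsetP=> y; rewrite inE => /exists_inP[x xB /exists_inP[z zB /exists_inP[w wB h]]].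
  by apply/bigcupP; exists x => //; apply/bigcupP; exists z => //; apply/bigcupP; exists w; rewrite ?inE.
apply: leq_trans (subset_leq_card sub) _; rewrite !expnS expn0.
apply: card_bigcup_leq => x _; apply: card_bigcup_leq => z _; apply: card_bigcup_leq => w _.
apply/card_le1_eqP => y1 y2; rewrite !inE => /andP[a1 /eqP e1] /andP[a2 /eqP e2].
by apply: (rep x); rewrite ?e1 ?e2.
Qed.

Lemma card_ksets_leq (T : finType) k : #|[set A : {set T} | #|A| == k]| <= #|T| ^ k.
Proof.
rewrite card_draws; elim: k => [|k IH]; first by rewrite bin0.
apply: leq_trans (_ : 'C(#|T|, k) * #|T| <= _); last by rewrite expnS mulnC leq_mul2l IH orbT.
have := mul_bin_left #|T| k; nia.
Qed.

(** Sets X with a vertex determined by F and the rest of X are sparse: at most a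
    constant times #|T| ^ j.-1 of them have size j. The free sets are
    those without a subset in the closure of this family. The parameter F allows
    for a few vertices that are fixed in advance. *)
Lemma free_system (r L : nat) : exists n0, forall (T : finType) (col : T -> T -> nat)
    (a : rel T) (F : {set T}),
  n0 <= #|T| -> #|F| <= 2 -> representative col a ->
  exists free : {set {set T}},
   [/\ set0 \in free,
       forall A B : {set T}, A \subset B -> B \in free -> A \in free,
       forall A, A \in free -> #|A| <= r -> L * #|[set v | (v \notin A) && (v |: A \notin free)]| <= #|T| &
       forall A, A \in free -> #|A| <= r.+1 -> forall y, y \in A -> y \notin determined col a (F :|: A :\ y)].
Proof.
have [n0 Hn0] := sparse_closure (L * (2 ^ r * r.+1)) r.+1 ((r + 2) ^ 3).
exists n0 => T col a F nT F2 rep.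
pose H := [set X : {set T} | (#|X| <= r.+1) && [exists y in X, y \in determined col a (F :|: X :\ y)]].
have [X|j|H' [sH H0 Hd]] := Hn0 T H nT; first by rewrite inE => /andP[].
  case: j => [|j].
    rewrite (_ : [set X in H | _] = set0) ?cards0 //; apply/setP=> X; rewrite !inE.
    by apply/negP=> /andP[/andP[_ /exists_inP[y yX _]]]; rewrite cards_eq0 => /eqP X0; rewrite X0 inE in yX.
  rewrite [#|T| ^ j.+1]expnSr mulnA leq_mul2r; apply/orP; right.
  have [jr|jr] := leqP j r; last first.
    rewrite (_ : [set X in H | _] = set0) ?cards0 //; apply/setP=> X; rewrite !inE.
    by apply/negP=> /andP[/andP[h _] /eqP h2]; lia.
  have sub : [set X in H | #|X| == j.+1] \subset
     \bigcup_(X' in [set A : {set T} | #|A| == j]) [set y |: X' | y in determined col a (F :|: X')].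
    apply/subsetP=> X; rewrite !inE => /andP[/andP[_ /exists_inP[y yX yd]] Xj].
    apply/bigcupP; exists (X :\ y); first by rewrite inE; have := cardsD1 y X; rewrite yX (eqP Xj); lia.
    by apply/imsetP; exists y => //; rewrite setD1K.
  apply: leq_trans (subset_leq_card sub) _.
  apply: leq_trans (card_bigcup_leq (m := (r + 2) ^ 3) _) _.
    move=> X'; rewrite inE => /eqP X'j; apply: leq_trans (leq_imset_card _ _) _.
    apply: leq_trans (card_determined _ rep) _; rewrite leq_exp2r //.
    by apply: leq_trans (leq_card_setU _ _) _; rewrite X'j addnC leq_add.
  by rewrite mulnC leq_mul2l card_ksets_leq orbT.
exists [set A : {set T} | ~~ [exists B : {set T}, (B \subset A) && (B \in H')]]; split.
- rewrite inE; apply/negP=> /existsP[B]; rewrite subset0 => /andP[/eqP->].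
  by rewrite (negPf H0).
- move=> A B sAB; rewrite !inE; apply: contra => /existsP[C /andP[sC CH]].
  by apply/existsP; exists C; rewrite (subset_trans sC sAB).
- move=> A; rewrite inE => fA Ar.
  set bad := [set v | _].
  (* A bad v completes some subset of A to a member of H', and A has at most 2 ^ r
     subsets, each of small extension degree. *)
  have sub : bad \subset \bigcup_(B in powerset A) [set v | (v \notin B) && (v |: B \in H')].
    apply/subsetP=> v; rewrite !inE negbK => /andP[vA /existsP[C /andP[sC CH]]].
    have vC : v \in C.
      apply: contraNT fA => vC; apply/existsP; exists C; rewrite CH andbT.
      apply/subsetP=> x xC; have := subsetP sC _ xC; rewrite !inE.
      by case: eqP => [xv|//]; rewrite -xv xC in vC.
    apply/bigcupP; exists (C :\ v); last by rewrite !inE eqxx /= setD1K.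
    rewrite inE; apply/subsetP=> x; rewrite !inE => /andP[xv xC].
    by have := subsetP sC _ xC; rewrite !inE (negPf xv).
  have M0 : 0 < 2 ^ r * r.+1 by rewrite muln_gt0 expn_gt0.
  have degB B : B \in powerset A -> L * (2 ^ r * r.+1) * ext_deg H' B <= r.+1 * #|T|.
    rewrite inE => sB; apply: Hd; apply: contra fA => BH; apply/existsP; exists B; exact/andP.
  rewrite -(leq_pmul2r M0).
  have cb : #|bad| <= \sum_(B in powerset A) ext_deg H' B.
    apply: leq_trans (subset_leq_card sub) _.
    elim/big_ind2: _ => [|m1 S1 m2 S2 h1 h2|//]; rewrite ?cards0 //.
    by apply: leq_trans (leq_card_setU _ _) (leq_add _ _).
  have : L * (2 ^ r * r.+1) * #|bad| <= \sum_(B in powerset A) r.+1 * #|T|.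
    apply: leq_trans (_ : _ <= L * (2 ^ r * r.+1) * \sum_(B in powerset A) ext_deg H' B) _.
      by rewrite leq_mul2l cb orbT.
    by rewrite big_distrr /=; apply: leq_sum.
  rewrite sum_nat_const card_powerset => h.
  have : 2 ^ #|A| <= 2 ^ r by rewrite leq_exp2l.
  nia.
move=> A; rewrite inE => fA Ar y yA; apply: contra fA => yd.
apply/existsP; exists A; rewrite subxx /=; apply: (subsetP sH).
by rewrite inE Ar; apply/exists_inP; exists y.
Qed.

(** * Missing arcs and energy *)
Section Energy.
Variables (T : finType) (a : rel T).
Hypothesis irr : irreflexive a.

(** As a has no loops, a vertex counts as non-adjacent to itself: repeating a vertex
    is as expensive as a non-adjacent pair. *)
Definition missing (x y : T) : nat := ~~ a x y + ~~ a y x.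
Definition one_way (x y : T) : bool := a x y && ~~ a y x.
Definition cost (x : T) (A : {set T}) : nat := \sum_(y in A) missing x y.
(** The sum runs over ordered pairs, so every unordered pair counts twice and the
    diagonal contributes 2 * #|A|. *)
Definition energy (A : {set T}) : nat := \sum_(x in A) cost x A.
Definition out_missing (x : T) : nat := #|[set y | ~~ a x y]|.
Definition in_missing (x : T) : nat := #|[set y | ~~ a y x]|.

Lemma missingC x y : missing x y = missing y x. Proof. by rewrite /missing addnC. Qed.
Lemma missingxx x : missing x x = 2. Proof. by rewrite /missing irr. Qed.
Lemma missing_le2 x y : missing x y <= 2. Proof. by rewrite /missing; do 2!case: (a _ _). Qed.

Lemma cost_setD1 x (A : {set T}) y : y \in A -> cost x A = missing x y + cost x (A :\ y).
Proof. by move=> yA; rewrite /cost (big_setD1 y yA). Qed.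

Lemma cost_setU1 x (A : {set T}) y : y \notin A -> cost x (y |: A) = missing x y + cost x A.
Proof. by move=> yA; rewrite /cost big_setU1. Qed.

Lemma missing_le_cost x (A : {set T}) y : y \in A -> missing x y <= cost x A.
Proof. by move=> yA; rewrite (cost_setD1 x yA) leq_addr. Qed.

Lemma cost_subset x (A B : {set T}) : A \subset B -> cost x A <= cost x B.
Proof.
move=> sAB; rewrite /cost [leqRHS](big_setID A) /= (setIidPr sAB); exact: leq_addr.
Qed.

Lemma energy_setU1 x (A : {set T}) : x \notin A -> energy (x |: A) = energy A + 2 * cost x A + 2.
Proof.
move=> xA; rewrite /energy big_setU1 //= cost_setU1 // missingxx.
rewrite (eq_bigr (fun y => missing y x + cost y A)); last by move=> y _; rewrite cost_setU1.
rewrite big_split /=.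
have -> : \sum_(y in A) missing y x = cost x A by apply: eq_bigr => y _; rewrite missingC.
lia.
Qed.

Lemma energy_setD1 x (A : {set T}) : x \in A -> energy A = energy (A :\ x) + 2 * cost x (A :\ x) + 2.
Proof. by move=> xA; rewrite -energy_setU1 ?setD1K // !inE eqxx. Qed.

Lemma sum_cost_swap (U A : {set T}) : \sum_(v in U) cost v A = \sum_(x in A) cost x U.
Proof.
rewrite /cost exchange_big /=; apply: eq_bigr => x _.
by apply: eq_bigr => y _; rewrite missingC.
Qed.

Lemma cost_setT x : cost x setT = out_missing x + in_missing x.
Proof.
rewrite /cost /missing big_split /=; congr (_ + _); rewrite -[RHS]sum1_card big_mkcond [RHS]big_mkcond;
by apply: eq_bigr => y _; rewrite !inE; case: (a _ _).
Qed.

Lemma sum_out_in_missing : \sum_x out_missing x = \sum_x in_missing x.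
Proof.
have h1 x : out_missing x = \sum_y (~~ a x y : nat).
  by rewrite /out_missing -sum1_card big_mkcond; apply: eq_bigr => y _; rewrite inE; case: (a _ _).
have h2 x : in_missing x = \sum_y (~~ a y x : nat).
  by rewrite /in_missing -sum1_card big_mkcond; apply: eq_bigr => y _; rewrite inE; case: (a _ _).
by rewrite (eq_bigr _ (fun x _ => h1 x)) [RHS](eq_bigr _ (fun x _ => h2 x)) exchange_big.
Qed.

Lemma energy_setT : energy setT = 2 * \sum_x out_missing x.
Proof.
rewrite /energy (eq_bigr (fun x => out_missing x + in_missing x)); last by move=> x _; rewrite cost_setT.
rewrite big_split /=.
have E (f : T -> nat) : \sum_(x in [set: T]) f x = \sum_x f x by apply: eq_bigl => x; rewrite inE.
by rewrite !E -sum_out_in_missing; lia.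
Qed.

Lemma energy_le A : energy A <= 2 * #|A| ^ 2.
Proof.
have h x : cost x A <= #|A| * 2.
  by rewrite -sum_nat_const; apply: leq_sum => y _; exact: missing_le2.
by apply: leq_trans (leq_sum _ (fun x _ => h x)) _; rewrite sum_nat_const; nia.
Qed.

(** Both sides split over the four blocks of X and its complement; this is used to
    see how the energy drops when expensive vertices are removed. *)
Lemma energy_setC X :
  energy setT + energy X = energy (~: X) + 2 * \sum_(x in X) cost x setT.
Proof.
have sp (f : T -> nat) : \sum_(x in [set: T]) f x = \sum_(x in X) f x + \sum_(x in ~: X) f x.
  by rewrite (big_setID X) /= setTI setTD.
have e1 (B : {set T}) : \sum_(x in B) cost x setT = \sum_(x in B) cost x X + \sum_(x in B) cost x (~: X).
  by rewrite -big_split; apply: eq_bigr => x _; rewrite /cost sp.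
by rewrite /energy sp !e1; have := sum_cost_swap (~: X) X; lia.
Qed.

(** The digraph condition that makes a free set a rainbow clique: all pairs are
    adjacent and no vertex receives two one-way arcs. *)
Definition admissible (S : {set T}) : Prop :=
  (forall x y, x \in S -> y \in S -> x != y -> missing x y <= 1) /\
  (forall x y z, x \in S -> y \in S -> z \in S -> y != z -> one_way y x -> one_way z x -> False).

Lemma one_way_missing x y : one_way x y -> missing x y = 1.
Proof. by rewrite /one_way /missing => /andP[-> ->]. Qed.

Lemma one_way_asym x y : one_way x y -> ~~ one_way y x.
Proof. by rewrite /one_way => /andP[-> _]; rewrite andbF. Qed.

Lemma one_way_le1 x y : one_way x y + one_way y x <= 1.
Proof. by rewrite /one_way; do 2!case: (a _ _). Qed.

Lemma one_way_neq x y : one_way x y -> x != y.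
Proof. by apply: contraTN => /eqP->; rewrite /one_way irr. Qed.

Lemma missing1_one_way x y : missing x y = 1 -> one_way x y || one_way y x.
Proof. by rewrite /one_way /missing; do 2!case: (a _ _). Qed.

Lemma missing0_arcs x y : missing x y = 0 -> a x y && a y x.
Proof. by rewrite /missing; do 2!case: (a _ _). Qed.

Lemma missing2_le_cost x (A : {set T}) y z : y \in A -> z \in A -> y != z -> missing x y + missing x z <= cost x A.
Proof.
move=> yA zA yz; rewrite (cost_setD1 x yA) leq_add2l missing_le_cost // !inE eq_sym yz; exact: zA.
Qed.

Lemma missing3_le_cost x (A : {set T}) y z w : y \in A -> z \in A -> w \in A -> y != z -> y != w -> z != w ->
  missing x y + missing x z + missing x w <= cost x A.
Proof.
move=> yA zA wA yz yw zw; rewrite (cost_setD1 x yA) -addnA leq_add2l missing2_le_cost // !inE ?zA ?wA andbT eq_sym //.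
Qed.

(** Cost at most 1 everywhere means that the one-way pairs form a matching. *)
Lemma matching_admissible (S : {set T}) :
  (forall s, s \in S -> cost s (S :\ s) <= 1) -> admissible S.
Proof.
move=> h; split=> [x y xS yS xy|x y z xS yS zS yz pyx pzx].
  by apply: leq_trans (h x xS); apply: missing_le_cost; rewrite !inE eq_sym xy.
have := @missing2_le_cost x (S :\ x) y z.
rewrite !inE yS zS (one_way_neq pyx) (one_way_neq pzx) => /(_ isT isT yz).
by rewrite missingC (one_way_missing pyx) missingC (one_way_missing pzx); have := h x xS; lia.
Qed.

Lemma cost0P x (A : {set T}) : cost x A = 0 -> forall y, y \in A -> missing x y = 0.
Proof. by move=> h y yA; have := missing_le_cost x yA; lia. Qed.

Lemma cost_gt0P x (A : {set T}) : 0 < cost x A -> exists2 y, y \in A & 0 < missing x y.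
Proof.
move=> h; case: (pickP (fun y => (y \in A) && (0 < missing x y))) => [y /andP[]|h0]; first by exists y.
by move: h; rewrite /cost big1 // => y yA; have := h0 y; rewrite yA /=; case: (missing x y).
Qed.
End Energy.

Section Neighbourhoods.
Variables (T : finType) (a : rel T).
Definition nonadj (v : T) : {set T} := [set w | missing a w v == 2].
Definition one_way_in (v : T) : {set T} := [set w | one_way a w v].
Definition one_way_out (v : T) : {set T} := [set w | one_way a v w].

Lemma out_missingE v : out_missing a v = #|nonadj v| + #|one_way_in v|.
Proof.
rewrite /out_missing -(cardsID (nonadj v)) /=; congr (_ + _); apply: eq_card => w;
  rewrite !inE /missing /one_way; by do 2!case: (a _ _).
Qed.

Lemma in_missingE v : in_missing a v = #|nonadj v| + #|one_way_out v|.
Proof.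
rewrite /in_missing -(cardsID (nonadj v)) /=; congr (_ + _); apply: eq_card => w;
  rewrite !inE /missing /one_way; by do 2!case: (a _ _).
Qed.
End Neighbourhoods.

Lemma subset_of_card (T : finType) (X : {set T}) k : k <= #|X| -> exists2 Y : {set T}, Y \subset X & #|Y| = k.
Proof.
move=> kX; exists [set x in take k (enum X)].
  by apply/subsetP=> x; rewrite inE => /mem_take; rewrite mem_enum.
by rewrite cardsE (card_uniqP _) ?take_uniq ?enum_uniq // size_takel // -cardE.
Qed.

(** * Free sets of least energy *)
Section Exchange.
Variables (T : finType) (a : rel T) (r e0 : nat) (free : {set {set T}}).
Hypothesis irr : irreflexive a.
Hypothesis free0 : set0 \in free.
Hypothesis freeS : forall A B : {set T}, A \subset B -> B \in free -> A \in free.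
Hypothesis freeX : forall A, A \in free -> #|A| <= r ->
  #|[set v | (v \notin A) && (v |: A \notin free)]| <= e0.
Hypothesis no_admissible : forall S, S \in free -> #|S| = r.+1 -> ~ admissible a S.

Notation cost := (cost a).
Notation energy := (energy a).
Variable n : nat.
Hypothesis cardT : #|T| = n.

Definition candidates (U A : {set T}) : {set T} :=
  [set v in U | (v \notin A) && (v |: A \in free)].

Lemma card_candidates (U A : {set T}) : A \in free -> #|A| <= r -> #|U| <= #|candidates U A| + #|A| + e0.
Proof.
move=> fA Ar; set B := [set v | (v \notin A) && (v |: A \notin free)].
have sub : U \subset (candidates U A :|: A) :|: B.
  by apply/subsetP=> v vU; rewrite !inE vU; case: (v \in A) => //=; case: (_ \in free).
apply: leq_trans (subset_leq_card sub) _; apply: leq_trans (leq_card_setU _ _) _.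
by apply: leq_add; [exact: leq_card_setU | exact: freeX].
Qed.

Lemma free_exists (U : {set T}) k : k <= r.+1 -> r + e0 < #|U| ->
  exists S, [/\ S \in free, S \subset U & #|S| = k].
Proof.
move=> + Ubig; elim: k => [_|k IH kr]; first by exists set0; rewrite free0 sub0set cards0.
have [S [fS sS Sk]] := IH (ltnW kr).
have /card_gt0P[v] : 0 < #|candidates U S|.
  have := card_candidates U fS; rewrite Sk; lia.
rewrite !inE => /and3P[vU vS vf]; exists (v |: S); split=> //; last by rewrite cardsU1 vS Sk.
by apply/subsetP=> x; rewrite !inE => /orP[/eqP->//|]; exact: (subsetP sS).
Qed.

Definition minfree (U : {set T}) (k : nat) (S : {set T}) : Prop :=
  [/\ S \in free, S \subset U, #|S| = k &
      forall S' : {set T}, S' \in free -> S' \subset U -> #|S'| = k -> energy S <= energy S'].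

Lemma minfree_exists (U : {set T}) k : k <= r.+1 -> r + e0 < #|U| -> exists S, minfree U k S.
Proof.
move=> kr Ubig; have [S0 [f0 s0 c0]] := free_exists kr Ubig.
pose P S := [&& S \in free, S \subset U & #|S| == k].
have P0 : P S0 by rewrite /P f0 s0 c0 eqxx.
case: (arg_minnP energy P0) => S /and3P[fS sS /eqP cS] mS.
by exists S; split=> // S' f' s' c'; apply: mS; rewrite /P f' s' c' eqxx.
Qed.

(** Exchanging s for v changes the energy by twice the difference of their costs to
    the rest of the set. *)
Lemma minfree_swap (U S : {set T}) k s v : minfree U k S -> s \in S -> v \in U -> v \notin S :\ s ->
  v |: S :\ s \in free -> cost s (S :\ s) <= cost v (S :\ s).
Proof.
case=> fS sS cS mS sS' vU vS vf.
have := mS _ vf; have c1 := cardsD1 s S; rewrite sS' in c1.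
have sub : v |: S :\ s \subset U.
  by apply/subsetP=> x; rewrite !inE => /orP[/eqP->//|/andP[_ /(subsetP sS)]].
rewrite sub cardsU1 vS (energy_setD1 irr sS') (energy_setU1 irr vS) => /(_ isT).
lia.
Qed.

(** Average the exchange inequality over all v in U that keep the set free. *)
Lemma minfree_average (U S : {set T}) k s m : minfree U k S -> k <= r.+1 -> s \in S ->
  m <= cost s (S :\ s) -> m * #|U| <= m * (r + e0) + \sum_(x in S :\ s) cost x U.
Proof.
move=> mS kr sS ms; case: (mS) => fS sSU cS _.
have c1 := cardsD1 s S; rewrite sS cS in c1.
have fA : S :\ s \in free by apply: freeS fS; apply: subD1set.
have h := @card_candidates U _ fA.
have h2 : #|candidates U (S :\ s)| * m <= \sum_(x in S :\ s) cost x U.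
  rewrite -sum_cost_swap -sum_nat_const.
  apply: (@leq_trans (\sum_(v in candidates U (S :\ s)) cost v (S :\ s))).
    apply: leq_sum => v; rewrite inE => /and3P[vU vS vf].
    by apply: leq_trans ms _; exact: minfree_swap mS sS vU vS vf.
  rewrite [leqRHS](big_setID (candidates U (S :\ s))) /= (setIidPr _) ?leq_addr //.
  by apply/subsetP=> v; rewrite inE => /andP[].
nia.
Qed.

(** Up to the error 4 n^2 / (p r), the energy of every vertex set U is at least
    2 * #|U|^2 / r. The constant (p - 1)/p leaves room for a strict inequality: if
    the bound fails for U, then a minimiser W of
    p r energy W - 2 (p - 1) #|W|^2 is large, and since deleting a vertex does not
    lower this functional, each single vertex of W has cost below 2 * #|W| / r
    within W. A free set of r + 1 vertices of W with least energy then has cost at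
    most 1 at each vertex. *)
Lemma energy_lower_bound (p : nat) (U : {set T}) : 0 < p -> 0 < r -> 3 * p ^ 2 * r + 2 * p ^ 2 * e0 < 2 * n ->
  2 * p * #|U| ^ 2 <= p * r * energy U + 4 * n ^ 2.
Proof.
move=> p0 r0 nbig; rewrite leqNgt; apply/negP=> hU.
(* Adding the constant 2 (p - 1) n^2 keeps the functional in nat. *)
pose G (W : {set T}) := p * r * energy W + 2 * p.-1 * (n ^ 2 - #|W| ^ 2).
have sq (W : {set T}) : #|W| ^ 2 <= n ^ 2 by rewrite leq_exp2r // -cardT max_card.
case: (@arg_minnP _ U xpredT G) => // W _ mW.
have W1 : p * r * energy W + 2 * n ^ 2 < 2 * p.-1 * #|W| ^ 2.
  have := mW U isT; rewrite /G; have := sq U; have := sq W.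
  case: p p0 hU {nbig mW G} => // p _; rewrite /=; nia.
have Wn : n < p * #|W|.
  rewrite ltnNge; apply/negP=> h; have h2 : (p * #|W|) ^ 2 <= n ^ 2 by rewrite leq_exp2r.
  by case: p p0 W1 h2 {hU nbig mW G h} => // p _; rewrite /= expnMn; nia.
have W2 : 3 * p * r + 2 * p * e0 < 2 * #|W|.
  have p2 : p ^ 2 = p * p by [].
  rewrite p2 in nbig; rewrite -(ltn_pmul2l p0).
  by apply: (@leq_trans (2 * n)); lia.
have Wv v : v \in W -> p * r * cost v W <= p.-1 * (2 * #|W|) + p * r.
  move=> vW; have := mW (W :\ v) isT; rewrite /G (energy_setD1 irr vW).
  have := sq W; have := cardsD1 v W; rewrite vW (cost_setD1 _ v vW) (missingxx irr) => ->.
  set k := #|W :\ v|; set c := cost _ _; set e := energy _.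
  rewrite add1n => hk hm.
  have kk : k.+1 ^ 2 = k ^ 2 + (2 * k + 1) by rewrite -addn1 sqrnD; lia.
  have e2 : n ^ 2 - k ^ 2 = n ^ 2 - k.+1 ^ 2 + (2 * k + 1) by rewrite kk in hk *; lia.
  by rewrite e2 !mulnDr in hm; move: hm; set d := n ^ 2 - _; lia.
have [||S mS] := @minfree_exists W r.+1; [by []| |].
  by have := leq_pmull r p0; have := leq_pmull e0 p0; lia.
case: (mS) => fS sS cS _; apply: (no_admissible fS cS).
apply: (matching_admissible irr) => s sS'; rewrite leqNgt; apply/negP=> hs.
have := minfree_average mS (leqnn _) sS' hs.
set Sg := \sum_(x in _) _ => h1.
have h2 : p * r * Sg <= r * (p.-1 * (2 * #|W|) + p * r).
  have c1 : #|S :\ s| = r by have := cardsD1 s S; rewrite sS' cS; lia.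
  rewrite /Sg big_distrr /= -[X in X * (_ + _)]c1 -sum_nat_const; apply: leq_sum => x.
  by rewrite !inE => /andP[_ xS]; apply: Wv; apply: (subsetP sS).
have h3 : p * Sg <= p.-1 * (2 * #|W|) + p * r.
  by rewrite -(leq_pmul2l r0) mulnA (mulnC r p).
case: p p0 h3 W2 {hU nbig mW G W1 Wn Wv h2} => // p _; rewrite /=; nia.
Qed.

Hypothesis out_missing_bound : forall x, r * out_missing a x <= n.
Hypothesis r_gt0 : 0 < r.

(** Almost all vertices miss about n/r arcs in each direction. Deleting k vertices
    of high cost would lower the average energy below its bound, so fewer than k
    vertices have high cost; no vertex misses more than n/r out-arcs, and the
    average is close to that value. The bounds combine because the
    total numbers of missing out-arcs and in-arcs agree. The parameters
    make n^2/p small against k^2, and k n small against e^2. *)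
Lemma regular_set (k p e : nat) : 0 < p -> 3 * p ^ 2 * r + 2 * p ^ 2 * e0 < 2 * n ->
  0 < k -> k <= n -> 2 * n ^ 2 <= p * k ^ 2 -> 14 * k * n <= e ^ 2 -> 4 * k <= e ->
  exists U : {set T}, n <= #|U| + e /\ forall v, v \in U ->
    [/\ n <= r * out_missing a v + r * e, n <= r * in_missing a v + r * e & r * in_missing a v <= n + r * e].
Proof.
move=> p0 pbig k0 kn pk ek e4.
have eT : r * energy setT <= 2 * n ^ 2.
  have : \sum_x r * out_missing a x <= n * n by rewrite -{1}cardT -sum_nat_const; apply: leq_sum.
  by rewrite energy_setT -big_distrr /=; lia.
have E1 : n ^ 2 <= r * (\sum_x out_missing a x) + k ^ 2.
  have := energy_lower_bound setT p0 r_gt0 pbig; rewrite energy_setT cardsT cardT => h.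
  rewrite -(leq_pmul2l p0); lia.
(* L1: too few missing out-arcs; X0: too high a cost; L2: too few missing
   in-arcs. *)
pose L1 := [set v | r * out_missing a v + 2 * r * k < n].
have cL1 : #|L1| <= k.
  have h : #|L1| * (2 * r * k) + r * (\sum_x out_missing a x) <= n ^ 2.
    rewrite big_distrr /= -sum_nat_const big_mkcond -big_split /=.
    apply: (@leq_trans (\sum_(x : T) n)); last by rewrite sum_nat_const cardT.
    apply: leq_sum => x _; rewrite inE; have := out_missing_bound x.
    by case: ltnP; lia.
  have h2 : #|L1| * (2 * r * k) <= k * k by lia.
  have h3 : #|L1| * (2 * r) <= k by rewrite -(leq_pmul2r k0) -mulnA.
  by apply: leq_trans h3; apply: leq_pmulr; lia.
pose X0 := [set v | 2 * n + 2 * r * k < r * cost v setT].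
have cX0 : #|X0| < k.
  rewrite ltnNge; apply/negP=> /subset_of_card[X sX cX].
  have hX : k * (2 * n + 2 * r * k) <= r * \sum_(x in X) cost x setT.
    rewrite -{1}cX big_distrr /= -sum_nat_const; apply: leq_sum => x /(subsetP sX).
    by rewrite inE => /ltnW.
  have := energy_lower_bound (~: X) p0 r_gt0 pbig.
  have := energy_setC a X; have := energy_le a X; have := cardsC X; rewrite cX cardT.
  set m := #|~: X|; set s := \sum_(x in X) _; set eX := energy X; set eC := energy (~: X).
  move=> km eXk eq lb.
  have h1 : r * eC + 2 * k * (2 * n + 2 * r * k) <= 2 * n ^ 2 + r * (2 * k ^ 2).
    have : r * (energy setT + eX) = r * (eC + 2 * s) by rewrite eq.
    have : r * eX <= r * (2 * k ^ 2) by rewrite leq_mul2l eXk orbT.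
    lia.
  have h2 : p * (r * eC + 2 * k * (2 * n + 2 * r * k)) <= p * (2 * n ^ 2 + r * (2 * k ^ 2)).
    by rewrite leq_mul2l h1 orbT.
  have n2 : n ^ 2 = k ^ 2 + 2 * k * m + m ^ 2 by rewrite -km sqrnD; lia.
  have pr : 0 < p * r * k ^ 2 by rewrite !muln_gt0 p0 r_gt0 k0.
  have nkm : p * (k * n) = p * (k ^ 2 + k * m) by rewrite -km mulnDr.
  rewrite n2 in h2 lb pk; lia.
pose L2 := [set v | r * in_missing a v + r * e < n].
have cL2 : 2 * #|L2| <= e.
  have h : #|L2| * (r * e) + r * \sum_x in_missing a x <= n * (n + 4 * r * k) + #|X0 :|: L1| * (r * n).
    have key x : (if x \in L2 then r * e else 0) + r * in_missing a x <=
        n + 4 * r * k + (if x \in X0 :|: L1 then r * n else 0).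
      rewrite !inE; have i1 : r * in_missing a x <= r * n by rewrite leq_mul2l -cardT max_card orbT.
      case: (ltnP (r * in_missing a x + r * e) n) => h1 /=; first by rewrite addnC; apply: leq_trans (ltnW h1) _; rewrite -addnA leq_addr.
      case: (ltnP (2 * n + 2 * r * k) (r * cost x setT)) => h2 /=.
        by apply: leq_trans i1 _; rewrite leq_addl.
      case: (ltnP (r * out_missing a x + 2 * r * k) n) => h3 /=.
        by apply: leq_trans i1 _; rewrite leq_addl.
      by rewrite cost_setT mulnDr in h2; rewrite /=; lia.
    have := leq_sum (index_enum T) (P := xpredT) (fun x _ => key x).
    by rewrite !big_split /= -!big_mkcond /= !sum_nat_const -big_distrr /= cardT mulnDr.
  rewrite -sum_out_in_missing in h.
  have c12 : #|X0 :|: L1| <= 2 * k by apply: leq_trans (leq_card_setU _ _) _; lia.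
  have h2 : #|X0 :|: L1| * (r * n) <= 2 * k * (r * n) by rewrite leq_mul2r c12 orbT.
  have kk : k ^ 2 <= r * (k * n).
    by apply: leq_trans (leq_pmull _ r_gt0); rewrite leq_mul2l kn orbT.
  have h3 : r * (#|L2| * e) <= r * (7 * k * n) by lia.
  rewrite leq_pmul2l // in h3.
  have e0' : 0 < e by lia.
  rewrite -(leq_pmul2r e0'); lia.
exists (~: (X0 :|: L1 :|: L2)); split.
  have := cardsC (X0 :|: L1 :|: L2); rewrite cardT.
  have := (leq_card_setU (X0 :|: L1) L2).1; have := (leq_card_setU X0 L1).1; lia.
have re : 4 * r * k <= r * e by rewrite -mulnA mulnCA leq_mul2l e4 orbT.
move=> v; rewrite !inE => /norP[/norP[]].
rewrite -!leqNgt cost_setT mulnDr => h1 h2 h3; split; lia.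
Qed.

(** * Least-energy sets of r vertices *)

(** From here on U is a set of regular vertices as above, d stands for n/r, e is
    the unit of error, and E collects the errors of one exchange argument. *)
Variables (d e : nat) (U : {set T}).
Hypothesis cardU : n <= #|U| + e.
Hypothesis rd_le : r * d <= n.
Hypothesis out_missing_le : forall v, out_missing a v <= d.
Hypothesis out_missing_ge : forall v, v \in U -> d <= out_missing a v + e.
Hypothesis in_missing_le : forall v, v \in U -> in_missing a v <= d + e.
Hypothesis in_missing_ge : forall v, v \in U -> d <= in_missing a v + e.
Hypothesis e0_le : e0 <= e.
Hypothesis r_le : r < e.
Let E := (r + 9) * e.
Hypothesis d_big : (r + 80) * E < d.

Notation missing := (missing a).
Notation one_way := (one_way a).

Lemma cost_le (v : T) : v \in U -> cost v U <= 2 * d + e.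
Proof.
move=> vU; apply: leq_trans (cost_subset a v (subsetT U)) _; rewrite cost_setT.
have := out_missing_le v; have := in_missing_le vU; lia.
Qed.

Lemma sum_cost_le (A : {set T}) : A \subset U -> \sum_(x in A) cost x U <= #|A| * (2 * d + e).
Proof.
move=> sA; rewrite -sum_nat_const; apply: leq_sum => x xA; apply: cost_le; exact: (subsetP sA _ xA).
Qed.

Lemma E_ge : 9 * e + r * e = E. Proof. by rewrite /E mulnDl addnC. Qed.

Lemma minfree_matching Q q : minfree U r Q -> q \in Q -> cost q (Q :\ q) <= 1.
Proof.
move=> mQ qQ; rewrite leqNgt; apply/negP=> hq; case: (mQ) => fQ sQ cQ _.
have := minfree_average mQ (leqnSn r) qQ hq.
have c1 := cardsD1 q Q; rewrite qQ cQ add1n in c1.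
have := sum_cost_le (subset_trans (subD1set Q q) sQ).
have e1 : #|Q :\ q| * (2 * d + e) + (2 * d + e) = 2 * (r * d) + r * e by rewrite -mulSnr -c1; lia.
have := E_ge; have : E <= (r + 80) * E by rewrite leq_pmull // addnC.
move: e1; set s := \sum_(x in _) _; set m := #|_| * _ => *; lia.
Qed.

Lemma candidatesP Q v : v \in candidates U Q -> [/\ v \in U, v \notin Q & v |: Q \in free].
Proof. by rewrite inE => /and3P[]. Qed.

Lemma swap_free Q q v : v |: Q \in free -> v |: Q :\ q \in free.
Proof. by apply: freeS; apply: setUS; apply: subD1set. Qed.

Lemma minfree_swap_le Q q v : minfree U r Q -> q \in Q -> v \in candidates U Q ->
  cost q (Q :\ q) <= cost v (Q :\ q).
Proof.
move=> mQ qQ /candidatesP[vU vQ vf].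
apply: (minfree_swap mQ qQ vU); last exact: swap_free.
by rewrite !inE negb_and vQ orbT.
Qed.

(** A vertex v missing at most one arc to Q would make v |: Q admissible. The only
    obstacle is a second one-way arc into some x in Q; but then v has no
    missing arc to the rest of Q, while x has one, and exchanging x for v lowers
    the energy. *)
Lemma minfree_cost_ge2 Q v : minfree U r Q -> v \in candidates U Q -> 2 <= cost v Q.
Proof.
move=> mQ vc; rewrite ltnNge; apply/negP=> hv; case: (mQ) => fQ sQ cQ _.
have [vU vQ vf] := candidatesP vc.
apply: (no_admissible vf); first by rewrite cardsU1 vQ cQ.
have mQQ x y : x \in Q -> y \in Q -> x != y -> missing x y <= 1.
  move=> xQ yQ xy; apply: leq_trans (minfree_matching mQ xQ); apply: missing_le_cost.
  by rewrite !inE eq_sym xy.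
have mvQ y : y \in Q -> missing v y <= 1 by move=> yQ; apply: leq_trans (missing_le_cost a v yQ) hv.
have key x z : x \in Q -> z \in Q -> one_way v x -> one_way z x -> False.
  move=> xQ zQ pv pz.
  have := minfree_swap_le mQ xQ vc.
  have := missing_le_cost a x (A := Q :\ x) (y := z).
  rewrite !inE zQ (one_way_neq irr pz) missingC (one_way_missing pz) => /(_ isT).
  by have := cost_setD1 a v xQ; rewrite (one_way_missing pv); move: hv; clear; lia.
split=> [x y|x y z]; rewrite !inE.
  move=> /orP[/eqP->|xQ] /orP[/eqP->|yQ]; rewrite ?eqxx // => xy; [exact: mvQ | | exact: mQQ].
  by rewrite missingC; exact: mvQ.
move=> /orP[/eqP->|xQ] /orP[/eqP->|yQ] /orP[/eqP->|zQ] yz py pz.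
- by rewrite eqxx in yz.
- by move: (one_way_neq irr py); rewrite eqxx.
- by move: (one_way_neq irr pz); rewrite eqxx.
- have := missing2_le_cost a v yQ zQ yz; rewrite missingC (one_way_missing py) missingC (one_way_missing pz); move: hv; clear; lia.
- by rewrite eqxx in yz.
- exact: key xQ zQ py pz.
- exact: key xQ yQ pz py.
have := @missing2_le_cost _ a x (Q :\ x) y z; rewrite !inE yQ zQ (one_way_neq irr py) (one_way_neq irr pz).
move=> /(_ isT isT yz); rewrite missingC (one_way_missing py) missingC (one_way_missing pz).
have := minfree_matching mQ xQ; clear; lia.
Qed.

Definition exceptional (Q : {set T}) : {set T} := ~: [set v in candidates U Q | cost v Q == 2].

Lemma exceptionalP Q v : v \notin exceptional Q -> v \in candidates U Q /\ cost v Q = 2.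
Proof. by rewrite !inE negbK => /andP[-> /eqP]. Qed.

(** The costs to Q are at least 2 for candidates and sum to at most about 2n. *)
Lemma card_exceptional Q : minfree U r Q -> #|exceptional Q| <= E.
Proof.
move=> mQ; case: (mQ) => fQ sQ cQ _.
have := card_candidates U fQ; rewrite cQ => /(_ (leqnn _)).
set C := candidates U Q => hC.
pose C2 := [set v in C | cost v Q == 2]; pose C3 := [set v in C | cost v Q != 2].
have h1 : #|C2| + #|C3| = #|C|.
  rewrite -(cardsID C2 C); congr (_ + _); apply: eq_card => v; rewrite !inE;
  by case: (v \in U); case: (v \in Q); case: (_ \in free); case: (_ == 2).
have h2 : #|C| * 2 + #|C3| <= r * (2 * d + e).
  apply: (@leq_trans (\sum_(v in C) cost v Q)); last first.
    have := sum_cost_le sQ; rewrite cQ; apply: leq_trans; rewrite -(sum_cost_swap a U Q).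
    rewrite [leqRHS](big_setID C) /= (setIidPr _) ?leq_addr //.
    by apply/subsetP=> v; rewrite inE => /andP[].
  have -> : #|C3| = \sum_(v in C) (cost v Q != 2).
    by rewrite -sum1_card big_mkcond [RHS]big_mkcond; apply: eq_bigr => v _; rewrite inE; case: (v \in C); case: (_ == 2).
  rewrite -sum_nat_const -big_split /=; apply: leq_sum => v vC.
  by have := minfree_cost_ge2 mQ vC; case: eqP; lia.
have h3 : #|exceptional Q| + #|C2| = n by rewrite addnC -cardT -(cardsC C2).
have := E_ge; rewrite -(leq_add2r #|C2|) h3.
have : r * (2 * d + e) = 2 * (r * d) + r * e by lia.
lia.
Qed.

(** Both sets have cost 2 to almost every w, and they differ only in b and v. *)
Lemma minfree_twin Q b v : minfree U r Q -> b \in Q -> v \notin exceptional Q ->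
  cost v (Q :\ b) = cost b (Q :\ b) ->
  minfree U r (v |: Q :\ b) /\
  forall w, w \notin exceptional Q -> w \notin exceptional (v |: Q :\ b) -> missing w v = missing w b.
Proof.
move=> mQ bQ /exceptionalP[/candidatesP[vU vQ vf] _] cvb; case: (mQ) => fQ sQ cQ eQ.
have vQb : v \notin Q :\ b by rewrite !inE negb_and vQ orbT.
split.
  split; [exact: swap_free| | |].
  - apply/subsetP=> x; rewrite !inE => /orP[/eqP->//|/andP[_]]; exact: (subsetP sQ).
  - by rewrite cardsU1 vQb; have := cardsD1 b Q; rewrite bQ cQ.
  - move=> S' fS' sS' cS'; have := eQ _ fS' sS' cS'.
    by rewrite (energy_setD1 irr bQ) (energy_setU1 irr vQb) cvb.
move=> w /exceptionalP[_ c1] /exceptionalP[_ c2].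
by rewrite (cost_setU1 a w vQb) in c2; rewrite (cost_setD1 a w bQ) in c1; lia.
Qed.

(** Since v misses two arcs to Q, it is in one-way position to q and to one
    further vertex of Q. If the arc of the first pair leaves v, then v receives at most
    one one-way arc and each vertex of Q at most one, so v |: Q is
    admissible. *)
Lemma bidirected_no_one_way_into Q v q : minfree U r Q ->
  (forall x, x \in Q -> cost x (Q :\ x) = 0) -> v \notin exceptional Q -> q \in Q -> ~~ one_way v q.
Proof.
move=> mQ Q0 vE qQ; apply/negP=> pvq; case: (mQ) => fQ sQ cQ _.
have [/candidatesP[vU vQ vf] c2] := exceptionalP vE.
have mQQ x y : x \in Q -> y \in Q -> x != y -> missing x y = 0.
  move=> xQ yQ xy; apply: (cost0P (Q0 x xQ)); by rewrite !inE eq_sym xy.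
have mvq := one_way_missing pvq.
have mv y : y \in Q -> missing v y <= 1.
  move=> yQ; have [->|yq] := eqVneq y q; first by rewrite mvq.
  have := missing2_le_cost a v yQ qQ yq; rewrite mvq c2; clear; lia.
apply: (no_admissible vf); first by rewrite cardsU1 vQ cQ.
split=> [x y|x y z]; rewrite !inE.
  move=> /orP[/eqP->|xQ] /orP[/eqP->|yQ]; rewrite ?eqxx // => xy; first exact: mv.
    by rewrite missingC; exact: mv.
  by rewrite mQQ.
move=> /orP[/eqP->|xQ] /orP[/eqP->|yQ] /orP[/eqP->|zQ] yz py pz.
- by rewrite eqxx in yz.
- by move: (one_way_neq irr py); rewrite eqxx.
- by move: (one_way_neq irr pz); rewrite eqxx.
- have qy : q != y by apply: contraTneq py => <-; exact: one_way_asym.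
  have qz : q != z by apply: contraTneq pz => <-; exact: one_way_asym.
  have := missing3_le_cost a v qQ yQ zQ qy qz yz.
  by rewrite mvq missingC (one_way_missing py) missingC (one_way_missing pz) c2.
- by rewrite eqxx in yz.
- by move: (one_way_missing pz); rewrite (mQQ _ _ zQ xQ) // (one_way_neq irr pz).
- by move: (one_way_missing py); rewrite (mQQ _ _ yQ xQ) // (one_way_neq irr py).
- by move: (one_way_missing pz); rewrite (mQQ _ _ zQ xQ) // (one_way_neq irr pz).
Qed.

(** Few one-way arcs enter a vertex q of Q, so q is non-adjacent to about d vertices,
    and as q also misses only about d in-arcs, few one-way arcs leave it. Hence
    almost every vertex is non-adjacent to exactly one q and bidirected to the
    others, and this is its part. A vertex of the part of q may be exchanged for
    q, so it is a twin of q. *)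
Lemma almost_partite_of_bidirected Q : minfree U r Q ->
  (forall x, x \in Q -> cost x (Q :\ x) = 0) ->
  let D := (2 * r + 4) * E in
  exists V : 'I_r -> {set T},
   [/\ forall i j v, v \in V i -> v \in V j -> i = j,
       n <= #|\bigcup_i V i| + D,
       forall i, d <= #|V i| + D &
       forall i v, v \in V i ->
         #|[set w | [exists j, (w \in V j) && (missing w v != if j == i then 2 else 0)]]| <= D].
Proof.
move=> mQ Q0 D; case: (mQ) => fQ sQ cQ _.
have EE := card_exceptional mQ; have Ege := E_ge.
pose V q := nonadj a q :\: exceptional Q.
have VP q v : v \in V q -> v \notin exceptional Q /\ missing v q = 2.
  by rewrite in_setD [v \in nonadj _ _]inE => /andP[-> /eqP].
have pinE q : q \in Q -> #|one_way_in a q| <= E.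
  move=> qQ; apply: leq_trans (subset_leq_card _) EE; apply/subsetP=> v; rewrite inE.
  by apply: contraTT => vE; exact: bidirected_no_one_way_into mQ Q0 vE qQ.
have nonE q : q \in Q -> d <= #|nonadj a q| + (e + E).
  move=> qQ; have := out_missing_ge (subsetP sQ _ qQ); have := pinE q qQ; rewrite out_missingE; clear; lia.
have poutE q : q \in Q -> #|one_way_out a q| <= 2 * e + E.
  move=> qQ; have := in_missing_le (subsetP sQ _ qQ); have := nonE q qQ; rewrite in_missingE; clear; lia.
have VE q : q \in Q -> d <= #|V q| + (e + 2 * E).
  move=> qQ; have := nonE q qQ; have := cardsID (exceptional Q) (nonadj a q).
  have : #|nonadj a q :&: exceptional Q| <= E by apply: leq_trans EE; apply: subset_leq_card; apply: subsetIr.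
  rewrite -/(V q); clear; lia.
have misE v : v \notin exceptional Q -> cost v Q = 2 by case/exceptionalP.
have Vuniq q q' v : q \in Q -> q' \in Q -> v \in V q -> q' != q -> missing v q' = 0.
  move=> qQ q'Q /VP[vE m2] qq.
  by have := missing2_le_cost a v qQ q'Q; rewrite eq_sym qq (misE _ vE) m2 => /(_ isT); clear; lia.
have cover : n <= #|\bigcup_(q in Q) V q| + (E + r * (2 * e + 2 * E)).
  have sub : setT \subset (\bigcup_(q in Q) V q :|: exceptional Q) :|: \bigcup_(q in Q) (one_way_in a q :|: one_way_out a q).
    apply/subsetP=> v _; rewrite in_setU in_setU; case vE: (v \in exceptional Q); first by rewrite orbT.
    have vE' : v \notin exceptional Q by rewrite vE.
    have /cost_gt0P[q qQ mq] : 0 < cost v Q by rewrite (misE _ vE').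
    have := missing_le2 a v q; rewrite leq_eqVlt => /orP[m2|m1].
      by apply/orP; left; rewrite orbF; apply/bigcupP; exists q => //; rewrite in_setD vE' inE.
    have {}m1 : missing v q = 1 by move: mq m1; case: (missing v q) => [|[]].
    apply/orP; right; apply/bigcupP; exists q => //; rewrite !inE; exact: missing1_one_way.
  have := subset_leq_card sub; rewrite cardsT cardT => h; apply: (leq_trans h).
  apply: leq_trans (leq_card_setU _ _) _; rewrite addnA; apply: leq_add.
    by apply: leq_trans (leq_card_setU _ _) _; rewrite leq_add2l.
  rewrite -cQ; apply: card_bigcup_leq => q qQ; apply: leq_trans (leq_card_setU _ _) _.
  have := pinE q qQ; have := poutE q qQ; clear; lia.
pose f (i : 'I_r) : T := enum_val (cast_ord (esym cQ) i).
have fQ' i : f i \in Q by apply: enum_valP.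
have finj : injective f by move=> i j /enum_val_inj /cast_ord_inj.
have fsur q : q \in Q -> exists i, f i = q.
  by move=> qQ; exists (cast_ord cQ (enum_rank_in qQ q)); rewrite /f cast_ordK enum_rankK_in.
have eE : 9 * e <= E by rewrite -Ege leq_addr.
have DE : D = 2 * (r * E) + 4 * E by rewrite /D mulnDl mulnA.
exists (fun i => V (f i)); split.
- move=> i j v vi vj; apply: finj; apply/eqP; apply: contraT => ij.
  have := Vuniq _ _ v (fQ' j) (fQ' i) vj ij.
  by have [_ ->] := VP _ _ vi.
- have -> : \bigcup_i V (f i) = \bigcup_(q in Q) V q.
    apply/setP=> v; apply/bigcupP/bigcupP => [[i _ vi]|[q qQ vq]]; first by exists (f i).
    by have [i fi] := fsur q qQ; exists i; rewrite ?fi.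
  apply: leq_trans cover _; rewrite leq_add2l DE.
  have : r * (9 * e) <= r * E by rewrite leq_mul2l eE orbT.
  have : r * E <= r * (r * E) by rewrite leq_mul2l leq_pmull ?orbT.
  have re : r * e <= E by rewrite -Ege leq_addl.
  rewrite mulnDr; move: re eE; clear; lia.
- move=> i; apply: leq_trans (VE _ (fQ' i)) _; rewrite leq_add2l DE.
  move: eE; clear; lia.
move=> i v vi.
have [vE mvi] := VP _ _ vi.
have cv : cost v (Q :\ f i) = cost (f i) (Q :\ f i).
  by rewrite (Q0 _ (fQ' i)); have := cost_setD1 a v (fQ' i); rewrite misE // mvi; clear; lia.
have [mQ' tw] := minfree_twin mQ (fQ' i) vE cv.
apply: (@leq_trans #|exceptional Q :|: exceptional (v |: Q :\ f i)|); last first.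
  apply: leq_trans (leq_card_setU _ _) _; have := card_exceptional mQ'; move: EE; rewrite DE; clear; lia.
apply: subset_leq_card; apply/subsetP=> w; rewrite inE in_setU => /existsP[j /andP[wj]].
apply: contraR; rewrite negb_or => /andP[wE wE']; rewrite tw //.
have [<-|ji] := eqVneq j i; first by have [_ ->] := VP _ _ wj.
by rewrite (Vuniq _ _ w (fQ' j) (fQ' i)) // (inj_eq finj) eq_sym.
Qed.

(** A vertex non-adjacent to b with total cost 2 could replace b at cost 0. *)
Lemma matched_nonadj_exceptional Q b w : minfree U r Q -> b \in Q -> 0 < cost b (Q :\ b) ->
  missing w b = 2 -> w \in exceptional Q.
Proof.
move=> mQ bQ cb m2; apply: contraT => wE; have [wc c2] := exceptionalP wE.
have := minfree_swap_le mQ bQ wc; have := cost_setD1 a w bQ.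
by move: cb c2 m2; clear; lia.
Qed.

(** A vertex in one-way position to b misses exactly one arc to the rest of Q, as
    does b. *)
Lemma matched_twin Q b v : minfree U r Q -> b \in Q -> 0 < cost b (Q :\ b) ->
  v \notin exceptional Q -> missing v b = 1 ->
  minfree U r (v |: Q :\ b) /\
  forall w, w \notin exceptional Q -> w \notin exceptional (v |: Q :\ b) -> missing w v = missing w b.
Proof.
move=> mQ bQ cb vE m1; have [vc c2] := exceptionalP vE.
apply: minfree_twin => //; have := cost_setD1 a v bQ; have := minfree_matching mQ bQ.
by move: cb c2 m1; clear; lia.
Qed.

(** Every vertex that is not exceptional and is in one-way position to b is so to
    exactly one further vertex q of Q. For some q there are many of them. Take two,
    v0 and u: u is a twin of b in Q, and after b has been exchanged for v0 the
    vertex q is matched with v0, so u is a twin of q as well. *)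
Lemma twin_partner Q b : minfree U r Q -> b \in Q -> 0 < cost b (Q :\ b) ->
  exists q (B : {set T}), [/\ q \in Q, q != b, exceptional Q \subset B, #|B| <= 4 * E &
    forall w, w \notin B -> missing w q = missing w b].
Proof.
move=> mQ bQ cb; case: (mQ) => fQ sQ cQ _; have EE := card_exceptional mQ.
pose K := (one_way_in a b :|: one_way_out a b) :\: exceptional Q.
have KP v : v \in K -> v \notin exceptional Q /\ missing v b = 1.
  rewrite in_setD !inE => /andP[-> /orP[/one_way_missing-> //|/one_way_missing]].
  by rewrite missingC.
have cK : 2 * d <= #|K| + 2 * e + 3 * E.
  have := cardsID (exceptional Q) (one_way_in a b :|: one_way_out a b); rewrite -/K.
  have : #|(one_way_in a b :|: one_way_out a b) :&: exceptional Q| <= E by apply: leq_trans EE; apply: subset_leq_card; apply: subsetIr.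
  have -> : #|one_way_in a b :|: one_way_out a b| = #|one_way_in a b| + #|one_way_out a b|.
    have : #|one_way_in a b :&: one_way_out a b| = 0.
      by apply: eq_card0 => w; rewrite !inE; apply/negP=> /andP[/one_way_asym/negPf->].
    by have := cardsUI (one_way_in a b) (one_way_out a b); clear; lia.
  have : #|nonadj a b| <= E.
    apply: leq_trans EE; apply: subset_leq_card; apply/subsetP=> w; rewrite inE => /eqP.
    exact: matched_nonadj_exceptional mQ bQ cb.
  have := out_missing_ge (subsetP sQ _ bQ); have := in_missing_ge (subsetP sQ _ bQ); rewrite out_missingE in_missingE.
  by clear; lia.
pose Kq q := [set v in K | missing v q == 1].
have [q qQb Kbig] : exists2 q, q \in Q :\ b & E < #|Kq q|.
  apply/exists_inP; apply: contraT; rewrite negb_exists_in => /forall_inP h.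
  have : #|K| <= r * E.
    apply: (@leq_trans (#|\bigcup_(q in Q :\ b) Kq q|)).
      apply: subset_leq_card; apply/subsetP=> v vK; have [vE m1] := KP v vK.
      have [_ c2] := exceptionalP vE; have := cost_setD1 a v bQ; rewrite c2 m1 => c1.
      have /cost_gt0P[q qQ mq] : 0 < cost v (Q :\ b) by move: c1; clear; lia.
      apply/bigcupP; exists q => //; rewrite inE vK /=.
      have := missing_le_cost a v qQ; move: mq c1; clear; lia.
    apply: leq_trans (card_bigcup_leq (m := E) _) _ => [q qQ|]; first by rewrite leqNgt h.
    by rewrite leq_mul2r -cQ subset_leq_card ?orbT // subD1set.
  have := E_ge; move: cK d_big; clear; set w := r * e; set z := r * E.
  rewrite mulnDl -/z; lia.
have [qb qQ] : q != b /\ q \in Q by move: qQb; rewrite !inE => /andP[].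
have /card_gt0P[v0] : 0 < #|Kq q| by apply: leq_ltn_trans Kbig.
rewrite inE => /andP[/KP[v0E m0b] /eqP m0q].
have [mQ0 tw0] := matched_twin mQ bQ cb v0E m0b.
set Q0 := v0 |: Q :\ b in mQ0 tw0.
have v0Q : v0 \notin Q by have [/candidatesP[]] := exceptionalP v0E.
have qQ0 : q \in Q0 by rewrite !inE qb qQ orbT.
have v0Q0 : v0 \in Q0 by rewrite !inE eqxx.
have qv0 : v0 != q by apply: contraNneq v0Q => ->.
have cq : 0 < cost q (Q0 :\ q).
  have := missing_le_cost a q (A := Q0 :\ q) (y := v0); rewrite !inE qv0 eqxx => /(_ isT).
  by rewrite missingC m0q.
have [u uK uE0] : exists2 u, u \in Kq q & u \notin exceptional Q0.
  apply/exists_inP; apply: contraT; rewrite negb_exists_in => /forall_inP h.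
  have : #|Kq q| <= #|exceptional Q0|.
    by apply: subset_leq_card; apply/subsetP=> u /h; rewrite negbK.
  by have := card_exceptional mQ0; move: Kbig; clear; lia.
move: uK; rewrite inE => /andP[/KP[uE mub] /eqP muq].
have [mQ1 tw1] := matched_twin mQ bQ cb uE mub.
have [mQ2 tw2] := matched_twin mQ0 qQ0 cq uE0 muq.
exists q, (exceptional Q :|: exceptional (u |: Q :\ b) :|: exceptional Q0 :|: exceptional (u |: Q0 :\ q)); split=> //.
- by rewrite -!setUA subsetUl.
- have := card_exceptional mQ1; have := card_exceptional mQ0; have := card_exceptional mQ2.
  have := (leq_card_setU (exceptional Q :|: exceptional (u |: Q :\ b) :|: exceptional Q0) (exceptional (u |: Q0 :\ q))).1.
  have := (leq_card_setU (exceptional Q :|: exceptional (u |: Q :\ b)) (exceptional Q0)).1.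
  have := (leq_card_setU (exceptional Q) (exceptional (u |: Q :\ b))).1.
  by move: EE; clear; lia.
move=> w; rewrite !in_setU !negb_or => /andP[/andP[/andP[w1 w2] w3] w4].
by rewrite -tw1 // -tw2.
Qed.

(** Let K be the set of unexceptional vertices in one-way position to b, hence also
    to its partner q and bidirected to the rest R of Q. All of K are twins of b, so
    K is almost a tournament on about 2d vertices, in which every vertex sends about
    d and receives about d one-way arcs. Take x in K with out-neighbours Y and
    in-neighbours Z in K. An arc from Y to Z closes a cyclic triangle, which
    together with R is admissible on r + 1 vertices. Without such arcs almost all of the d arcs out
    of each y in Y stay in Y, while a tournament on the about d vertices of Y has a
    vertex of out-degree at most d/2. *)
Lemma no_matched_pair Q b : minfree U r Q -> b \in Q -> 0 < cost b (Q :\ b) -> False.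
Proof.
move=> mQ bQ cb; case: (mQ) => fQ sQ cQ _; have EE := card_exceptional mQ.
have [q [B [qQ qb sB cB twB]]] := twin_partner mQ bQ cb.
pose K := (one_way_in a b :|: one_way_out a b) :\: B.
have KP v : v \in K -> [/\ v \notin exceptional Q, missing v b = 1 & missing v q = 1].
  rewrite in_setD in_setU [v \in one_way_in _ _]inE [v \in one_way_out _ _]inE => /andP[vB h].
  have m1 : missing v b = 1 by case/orP: h => /one_way_missing //; rewrite missingC.
  by split=> //; [apply: contra vB; apply: (subsetP sB) | rewrite twB].
have KI v : v \notin B -> missing v b = 1 -> v \in K.
  by move=> vB m1; rewrite in_setD vB !inE missing1_one_way.
pose R := Q :\ b :\ q.
have RQ x : x \in R -> x \in Q by rewrite !inE => /and3P[].
have KR v x : v \in K -> x \in R -> missing v x = 0.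
  move=> /KP[vE mb mq]; rewrite !inE => /and3P[xq xb xQ].
  have [_ c2] := exceptionalP vE.
  by have := missing3_le_cost a v bQ qQ xQ; rewrite eq_sym qb eq_sym xb eq_sym xq c2 mb mq => /(_ isT isT isT); clear; lia.
have KQ v : v \in K -> v \notin Q /\ v |: Q \in free.
  by case/KP => /exceptionalP[/candidatesP[]].
have KU v : v \in K -> v \in U by case/KP => /exceptionalP[/candidatesP[]].
(* Being a twin of b, v sends and receives almost all its one-way arcs within K. *)
have Klarge v : v \in K -> d <= #|one_way_out a v :&: K| + (e + 10 * E) /\ d <= #|one_way_in a v :&: K| + (e + 10 * E).
  move=> vK; have [vE mb _] := KP v vK.
  have [mQv twv] := matched_twin mQ bQ cb vE mb.
  pose X := B :|: exceptional (v |: Q :\ b).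
  have cX : #|X| <= 5 * E.
    have := (leq_card_setU B (exceptional (v |: Q :\ b))).1; rewrite -/X; have := card_exceptional mQv.
    by move: cB; clear; lia.
  have XP w : w \notin X -> missing w v = missing w b.
    by rewrite in_setU negb_or => /andP[wB wE]; apply: twv => //; apply: contra wB; apply: (subsetP sB).
  have cN : #|nonadj a v| <= 5 * E.
    apply: leq_trans cX; apply: subset_leq_card; apply/subsetP=> w; rewrite inE => /eqP m2.
    apply: contraT => wX; rewrite (XP _ wX) in m2.
    have := matched_nonadj_exceptional mQ bQ cb m2.
    by move: wX; rewrite in_setU negb_or => /andP[wB _] /(subsetP sB); rewrite (negPf wB).
  have XK (P : {set T}) : (forall w, w \in P -> missing w v = 1) -> #|P| <= #|P :&: K| + 5 * E.
    move=> P1; have := cardsID K P; have : #|P :\: K| <= #|X|; last by move: cX; clear; lia.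
    apply: subset_leq_card; apply/subsetP=> w; rewrite in_setD => /andP[wK wP].
    apply: contraT => wX; move: wK; rewrite KI //; first by move: wX; rewrite in_setU negb_or => /andP[].
    by rewrite -XP // P1.
  have o1 : #|one_way_out a v| <= #|one_way_out a v :&: K| + 5 * E.
    by apply: XK => w; rewrite inE => /one_way_missing; rewrite missingC.
  have i1 : #|one_way_in a v| <= #|one_way_in a v :&: K| + 5 * E by apply: XK => w; rewrite inE => /one_way_missing.
  have := out_missing_ge (KU _ vK); have := in_missing_ge (KU _ vK); rewrite out_missingE in_missingE.
  by move: o1 i1 cN; clear; lia.
have cK : #|K| <= 2 * d + e.
  apply: (@leq_trans #|one_way_in a b :|: one_way_out a b|); first by apply: subset_leq_card; exact: subsetDl.
  apply: leq_trans (leq_card_setU _ _) _.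
  have := out_missing_le b; have := in_missing_le (subsetP sQ _ bQ); rewrite out_missingE in_missingE; clear; lia.
have eE : 9 * e <= E by rewrite -E_ge leq_addr.
have rE : 80 * E <= (r + 80) * E by rewrite leq_mul2r leq_addl orbT.
have [x xK] : exists x, x \in K.
  have [v] : exists v, v \in one_way_out a b :\: B.
    apply/set0Pn; rewrite -card_gt0; have := cardsID B (one_way_out a b).
    have : #|one_way_out a b :&: B| <= 4 * E by apply: leq_trans cB; apply: subset_leq_card; apply: subsetIr.
    have : #|nonadj a b| <= E.
      apply: leq_trans EE; apply: subset_leq_card; apply/subsetP=> w; rewrite inE => /eqP.
      exact: matched_nonadj_exceptional mQ bQ cb.
    have := in_missing_ge (subsetP sQ _ bQ); rewrite in_missingE.
    by move: eE rE d_big; clear; lia.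
  by rewrite in_setD => /andP[vB vb]; exists v; rewrite in_setD vB in_setU vb orbT.
have xR : x \notin R by apply: contra (proj1 (KQ x xK)); apply: RQ.
have cR : #|R|.+2 = r.
  have := cardsD1 b Q; have := cardsD1 q (Q :\ b); rewrite !inE qb qQ bQ cQ /R; clear; lia.
pose A := x |: R.
have cA : #|A| = r.-1 by rewrite cardsU1 xR -cR.
have fA : A \in free.
  apply: freeS (proj2 (KQ x xK)); apply: setUS; apply/subsetP=> y; exact: RQ.
pose Z := one_way_in a x :&: K.
pose Y := [set y in one_way_out a x :&: K | y |: A \in free].
have [cY0] := Klarge x xK; rewrite -/Z => cZ.
have notA y : y \in K -> y != x -> y \notin A.
  move=> yK yx; rewrite in_setU1 negb_or yx /=; apply: contra (proj1 (KQ y yK)); exact: RQ.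
have cY : #|one_way_out a x :&: K| <= #|Y| + e.
  have := cardsID [set y | y |: A \in free] (one_way_out a x :&: K).
  have -> : #|one_way_out a x :&: K :&: [set y | y |: A \in free]| = #|Y| by apply: eq_card => y; rewrite !inE.
  have : #|(one_way_out a x :&: K) :\: [set y | y |: A \in free]| <= e.
    apply: leq_trans e0_le; apply: leq_trans (freeX fA _); last by rewrite cA leq_pred.
    apply: subset_leq_card; apply/subsetP=> y; rewrite in_setD [y \in [set _ | _]]inE => /andP[yf].
    rewrite in_setI [y \in one_way_out _ _]inE => /andP[pxy yK].
    have yA : y \notin A by apply: notA => //; rewrite eq_sym; exact: (one_way_neq irr pxy).
    by rewrite inE yA yf.
  by clear; lia.
have YP y : y \in Y -> [/\ one_way x y, y \in K & y |: A \in free].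
  by rewrite inE in_setI [y \in one_way_out _ _]inE => /andP[/andP[-> ->] ->].
have mQQ u v : u \in Q -> v \in Q -> u != v -> missing u v <= 1.
  move=> uQ vQ uv; apply: leq_trans (minfree_matching mQ uQ); apply: missing_le_cost.
  by rewrite !inE eq_sym uv.
(* The three arcs of the cycle give one one-way arc into each of x, y, z, and
   R is bidirected to them. *)
have noZ y z : y \in Y -> z \in Z -> one_way y z -> z |: (y |: A) \notin free.
  move=> /YP[pxy yK yf]; rewrite in_setI [z \in one_way_in _ _]inE => /andP[pzx zK] pyz; apply/negP=> zf.
  have xy := one_way_neq irr pxy; have yz := one_way_neq irr pyz; have zx := one_way_neq irr pzx.
  have nyx := one_way_asym pxy.
  have nzy := one_way_asym pyz.
  have nxz := one_way_asym pzx.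
  have yA : y \notin A by apply: notA => //; rewrite eq_sym.
  have zyA : z \notin y |: A by rewrite in_setU1 negb_or eq_sym yz notA.
  apply: (no_admissible zf); first by rewrite cardsU1 zyA cardsU1 yA cA -cR.
  pose C := [set x; y; z].
  have CK u : u \in C -> u \in K by case/setUP=> [/set2P[]|/set1P] ->.
  have SE u : (u \in z |: (y |: A)) = (u \in C) || (u \in R).
    by rewrite /A !in_setU1 !inE; case: (u == x); case: (u == y); case: (u == z); rewrite ?orbT.
  have CC u v : u \in C -> v \in C -> u != v -> missing u v <= 1.
    rewrite !inE => /orP[/orP[]|] /eqP-> /orP[/orP[]|] /eqP->; rewrite ?eqxx // => _;
    by rewrite ?(one_way_missing pxy, one_way_missing pyz, one_way_missing pzx) // missingC ?(one_way_missing pxy, one_way_missing pyz, one_way_missing pzx).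
  have inC t u : t \in C -> u \in C -> one_way u t -> (t, u) \in [:: (x, z); (y, x); (z, y)].
    rewrite !inE => /orP[/orP[]|] /eqP-> /orP[/orP[]|] /eqP-> p; rewrite ?eqxx ?orbT //.
    - by move: (one_way_neq irr p); rewrite eqxx.
    - by rewrite p in nyx.
    - by move: (one_way_neq irr p); rewrite eqxx.
    - by rewrite p in nzy.
    - by rewrite p in nxz.
    - by move: (one_way_neq irr p); rewrite eqxx.
  split=> [u v|t u v]; rewrite !SE.
    move=> /orP[uC|uR] /orP[vC|vR] uv; [exact: CC | by rewrite KR // CK | by rewrite missingC KR // CK|].
    by apply: mQQ => //; exact: RQ.
  have noCR u' v' : u' \in C -> v' \in R -> one_way u' v' -> False.
    by move=> uC vR /one_way_missing; rewrite KR // CK.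
  have noRC u' v' : u' \in R -> v' \in C -> one_way u' v' -> False.
    by move=> uR vC /one_way_missing; rewrite missingC KR // CK.
  move=> /orP[tC|tR] /orP[uC|uR] /orP[vC|vR] uv put pvt.
  - have := inC _ _ tC uC put; have := inC _ _ tC vC pvt; rewrite !inE !xpair_eqE.
    by move: uv xy yz zx; clear; do !case: eqP => //=; congruence.
  - exact: noRC vR tC pvt.
  - exact: noRC uR tC put.
  - exact: noRC uR tC put.
  - exact: noCR uC tR put.
  - exact: noCR uC tR put.
  - exact: noCR vC tR pvt.
  have := @missing2_le_cost _ a t (Q :\ t) u v; rewrite !inE (RQ _ uR) (RQ _ vR) (one_way_neq irr put) (one_way_neq irr pvt).
  move=> /(_ isT isT uv); rewrite missingC (one_way_missing put) missingC (one_way_missing pvt).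
  have := minfree_matching mQ (RQ _ tR); clear; lia.
have YZ : #|Y| + #|Z| + #|K :\: (Y :|: Z)| = #|K|.
  rewrite -(cardsID (Y :|: Z) K); congr (_ + _).
  have -> : K :&: (Y :|: Z) = Y :|: Z.
    apply/setIidPr; apply/subsetP=> w; rewrite in_setU => /orP[/YP[]//|].
    by rewrite in_setI => /andP[].
  have : #|Y :&: Z| = 0.
    apply: eq_card0 => w; rewrite in_setI; apply/negP=> /andP[/YP[pw _ _]].
    by rewrite in_setI inE (negPf (one_way_asym pw)).
  by have := cardsUI Y Z; clear; lia.
have degY y : y \in Y -> d <= #|one_way_out a y :&: Y| + (6 * e + 30 * E).
  move=> yY; have [pxy yK yf] := YP y yY.
  have [lY _] := Klarge y yK.
  have c1 : #|y |: A| <= r by rewrite cardsU1 cA; case: (_ \notin _) => /=; move: r_gt0; clear; lia.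
  have h1 : #|one_way_out a y :&: Z| <= e.
    apply: leq_trans e0_le; apply: leq_trans (freeX yf c1).
    apply: subset_leq_card; apply/subsetP=> z; rewrite in_setI [z \in one_way_out _ _]inE => /andP[pyz zZ].
    move: (zZ); rewrite in_setI [z \in one_way_in _ _]inE => /andP[pzx zK].
    have zA : z \notin A by apply: notA => //; exact: (one_way_neq irr pzx).
    have zyA : z \notin y |: A by rewrite in_setU1 negb_or eq_sym (one_way_neq irr pyz).
    by rewrite inE zyA noZ.
  have sub : one_way_out a y :&: K \subset (one_way_out a y :&: Z) :|: (one_way_out a y :&: Y) :|: (K :\: (Y :|: Z)).
    apply/subsetP=> w /setIP[wp wK].
    rewrite in_setU in_setU [w \in _ :&: Z]in_setI [w \in _ :&: Y]in_setI in_setD [w \in Y :|: Z]in_setU wp wK.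
    by case: (w \in Y); case: (w \in Z).
  have := subset_leq_card sub.
  have := (leq_card_setU (one_way_out a y :&: Z :|: one_way_out a y :&: Y) (K :\: (Y :|: Z))).1.
  have := (leq_card_setU (one_way_out a y :&: Z) (one_way_out a y :&: Y)).1.
  by move: h1 lY YZ cK cY cY0 cZ; clear; lia.
have tour : 2 * \sum_(y in Y) #|one_way_out a y :&: Y| <= #|Y| * #|Y|.
  have e1 : \sum_(y in Y) #|one_way_out a y :&: Y| = \sum_(y in Y) \sum_(w in Y) one_way y w.
    apply: eq_bigr => y _; rewrite -sum1_card big_mkcond [RHS]big_mkcond; apply: eq_bigr => w _.
    by rewrite in_setI [w \in one_way_out _ _]inE; case: (w \in Y); case: (one_way y w).
  have e2 : \sum_(y in Y) #|one_way_out a y :&: Y| = \sum_(y in Y) \sum_(w in Y) one_way w y by rewrite e1 exchange_big.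
  rewrite mul2n -addnn {1}e1 e2 -big_split /= -sum_nat_const; apply: leq_sum => y _.
  rewrite -big_split /= -sum1_card; apply: leq_sum => w _; exact: one_way_le1.
have : 2 * (#|Y| * (d - (6 * e + 30 * E))) <= #|Y| * #|Y|.
  apply: leq_trans tour; rewrite leq_mul2l /= -sum_nat_const; apply: leq_sum => y yY.
  by rewrite leq_subLR addnC degY.
have Ypos : 0 < #|Y| by move: cY cY0 eE rE d_big; clear; lia.
rewrite mulnCA leq_pmul2l // => h.
by move: h cY cY0 cZ YZ cK eE rE d_big; clear; lia.
Qed.

Lemma almost_partite :
  let D := (2 * r + 4) * E in
  exists V : 'I_r -> {set T},
   [/\ forall i j v, v \in V i -> v \in V j -> i = j,
       n <= #|\bigcup_i V i| + D,
       forall i, d <= #|V i| + D &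
       forall i v, v \in V i ->
         #|[set w | [exists j, (w \in V j) && (missing w v != if j == i then 2 else 0)]]| <= D].
Proof.
have eE : 9 * e <= E by rewrite -E_ge leq_addr.
have rE : 80 * E <= (r + 80) * E by rewrite leq_mul2r leq_addl orbT.
have dn : d <= r * d by rewrite leq_pmull.
have [||Q mQ] := @minfree_exists U r; first exact: leqnSn.
  by move: e0_le r_le cardU rd_le dn eE rE d_big; clear; lia.
apply: (almost_partite_of_bidirected mQ) => b bQ; apply/eqP; rewrite -leqn0 leqNgt; apply/negP.
exact: no_matched_pair mQ bQ.
Qed.
End Exchange.

(** Choice of the parameters: the error D is at most n/t for any prescribed t, once
    the free sets extend by all but n/L vertices and n is large. *)
Lemma near_partite (r t : nat) : 0 < r -> exists n0 L, forall (T : finType) (a : rel T)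
    (free : {set {set T}}) (n : nat),
  #|T| = n -> n0 <= n -> irreflexive a -> set0 \in free ->
  (forall A B : {set T}, A \subset B -> B \in free -> A \in free) ->
  (forall A, A \in free -> #|A| <= r ->
     L * #|[set v | (v \notin A) && (v |: A \notin free)]| <= n) ->
  (forall S, S \in free -> #|S| = r.+1 -> ~ admissible a S) ->
  (forall x, r * out_missing a x <= n) ->
  exists (V : 'I_r -> {set T}) (D : nat), 0 < D /\ t * D <= n /\
   [/\ forall i j v, v \in V i -> v \in V j -> i = j,
       n <= #|\bigcup_i V i| + D,
       forall i, n <= r * (#|V i| + D) &
       forall i v, v \in V i ->
         #|[set w | [exists j, (w \in V j) && (missing a w v != if j == i then 2 else 0)]]| <= D].
Proof.
move=> r0.
(* c and t' convert the error units: D < c e and t' e <= n. *)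
pose c := (2 * r + 4) * (r + 9) + 1.
pose t' := t * c + r * (r + 80) * (r + 9) + r.
pose q := 28 * t' ^ 2; pose p := 8 * q ^ 2; pose L := 2 * p ^ 2 + 2 * q.
exists (3 * p ^ 2 * r + q + 1), L => T a free n cT nbig irr f0 fS fX no_admissible out_missing_bound.
have t'0 : 0 < t' by rewrite /t' addn_gt0 r0 orbT.
have q0 : 0 < q by rewrite muln_gt0 expn_gt0 t'0.
have p0 : 0 < p by rewrite muln_gt0 expn_gt0 q0.
have L0 : 0 < L by rewrite addn_gt0 muln_gt0 expn_gt0 p0.
pose k := n %/ q; pose e := 28 * t' * k; pose e0 := n %/ L.
have k0 : 0 < k by rewrite divn_gt0 //; move: nbig; clear; lia.
have kq : q * k <= n by rewrite mulnC leq_divM.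
have nk : n <= 2 * q * k.
  have := ltn_ceil n q0; rewrite -/k => h; apply: (leq_trans (ltnW h)).
  have -> : 2 * q * k = (k + k) * q by lia.
  by rewrite leq_mul2r -addn1 leq_add2l k0 orbT.
have e0L : e0 * L <= n by apply: leq_divM.
have te : t' * e <= n by apply: leq_trans kq; rewrite /e /q; lia.
have e00 : e0 <= e.
  rewrite -(leq_pmul2l L0) mulnC; apply: (leq_trans e0L); apply: (leq_trans nk).
  rewrite leq_mul //; first by rewrite leq_addl.
  by rewrite leq_pmull // muln_gt0.
have fX0 A : A \in free -> #|A| <= r -> #|[set v | (v \notin A) && (v |: A \notin free)]| <= e0.
  by move=> fA Ar; rewrite leq_divRL // mulnC fX.
have [||||||U [cU UP]] := @regular_set T a r e0 free irr f0 fS fX0 no_admissible n cT out_missing_bound r0 k p e p0.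
- have h : e0 * (2 * p ^ 2) <= n by apply: leq_trans e0L; rewrite leq_mul2l leq_addr orbT.
  have aux P Q R E N : E * (2 * P) <= N -> 3 * P * R + Q + 1 <= N -> 3 * P * R + 2 * P * E < 2 * N.
    by clear; lia.
  exact: aux h nbig.
- by [].
- by apply: leq_trans kq; rewrite leq_pmull.
- have h : n ^ 2 <= (2 * q * k) ^ 2 by rewrite leq_exp2r.
  by move: h; rewrite /p !expnMn; clear; lia.
- have : 14 * k * n <= 14 * k * (2 * q * k) by rewrite leq_mul2l nk orbT.
  by rewrite /q /e !expnMn; clear; lia.
- rewrite /e leq_mul2r; apply/orP; right; rewrite (@leq_trans (28 * 1)) // leq_mul2l t'0 orbT //.
pose d := n %/ r.
have rd : r * d <= n by rewrite mulnC leq_divM.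
have dr : n < r * d + r by have := ltn_ceil n r0; rewrite -/d mulSn mulnC addnC.
have rt : r <= t' by rewrite leq_addl.
have re : r < e.
  apply: (leq_ltn_trans rt); rewrite /e mulnAC; apply: (@leq_trans (28 * k * t')); last by [].
  by rewrite -[X in X < _]mul1n ltn_pmul2r // (@leq_trans (28 * 1)) // leq_mul2l k0 orbT.
have e_gt0 : 0 < e by apply: leq_ltn_trans re.
have dbig : (r + 80) * ((r + 9) * e) < d.
  rewrite leq_divRL //; apply: leq_trans te; rewrite /t' !mulnDl.
  have : r * 1 <= r * e by rewrite leq_mul2l e_gt0 orbT.
  by clear; lia.
have [v|v|v|v|V [disj cov big near]] :=
    @almost_partite T a r e0 free irr f0 fS fX0 no_admissible n cT r0 d e U cU rd _ _ _ _ e00 re dbig.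
- by rewrite leq_divRL // mulnC out_missing_bound.
- move=> /UP[h _ _]; rewrite -(leq_pmul2l r0) mulnDr; exact: leq_trans rd h.
- move=> /UP[_ _ h]; rewrite -ltnS -(ltn_pmul2l r0); apply: (leq_ltn_trans h).
  by rewrite mulnS mulnDr; move: dr; clear; lia.
- move=> /UP[_ h _]; rewrite -(leq_pmul2l r0) mulnDr; exact: leq_trans rd h.
set D := (2 * r + 4) * ((r + 9) * e) in cov big near.
exists V, D.+1; split=> //; split.
  apply: leq_trans te; rewrite /t' !mulnDl.
  have : t * D.+1 <= t * c * e.
    rewrite -mulnA leq_mul2l; apply/orP; right; have -> : c * e = D + e by rewrite /c mulnDl mul1n -mulnA.
    by rewrite -addn1 leq_add2l.
  by move/leq_trans; apply; rewrite -addnA leq_addr.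
split=> //.
- by apply: (leq_trans cov); rewrite leq_add2l.
- move=> i; apply: (ltnW (leq_trans dr _)); rewrite addnC -mulnS leq_mul2l addnS ltnS big orbT //.
- by move=> i v vi; apply: leq_trans (near i v vi) _.
Qed.

(** * Rainbow cliques from free sets *)
Section Colouring.
Variables (T : finType) (g : rel T) (col : T -> T -> nat) (a : rel T).
Hypothesis g_irr : irreflexive g.
Hypothesis g_sym : symmetric g.
Hypothesis colC : forall x y, col x y = col y x.
Hypothesis arc_edge : forall x y, a x y -> g x y.

(** Distinct edges of equal colour either share a vertex or are disjoint; the two
    cases are kept apart because they are excluded for different reasons. *)
Definition rainbow_clique (S : {set T}) : Prop :=
  [/\ forall x y, x \in S -> y \in S -> x != y -> g x y,
      forall x y z, x \in S -> y \in S -> z \in S -> x != y -> x != z -> y != z ->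
        col x y <> col x z &
      forall x y z w, x \in S -> y \in S -> z \in S -> w \in S ->
        x != y -> x != z -> x != w -> y != z -> y != w -> z != w -> col x y <> col z w].

Lemma a_irr : irreflexive a.
Proof. by move=> x; apply/negP=> /arc_edge; rewrite g_irr. Qed.

Lemma missing_le1_arc x y : missing a x y <= 1 -> a x y || a y x.
Proof. by rewrite /missing; do 2!case: (a _ _). Qed.

Lemma distinct_colors_of_free_arc (F A : {set T}) x y z w :
  (forall y, y \in A -> y \notin determined col a (F :|: A :\ y)) ->
  x \in F :|: A -> y \in A -> z \in F :|: A -> w \in F :|: A ->
  x != y -> z != y -> w != y -> a x y -> col x y <> col z w.
Proof.
move=> fA xS yA zS wS xy zy wy axy e; have := fA y yA; rewrite (@determinedP _ _ _ _ x y z w) //.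
- by move: xS; rewrite !inE xy.
- by move: zS; rewrite !inE zy.
- by move: wS; rewrite !inE wy.
Qed.

(** Of two equally coloured edges at x, an arc out of x would determine its head; so
    both are one-way arcs into x, which admissibility excludes. *)
Lemma rainbow_admissible (A : {set T}) :
  (forall y, y \in A -> y \notin determined col a (set0 :|: A :\ y)) ->
  admissible a A -> rainbow_clique A.
Proof.
move=> fA [m1 ind].
have key x y z w : x \in A -> y \in A -> z \in A -> w \in A ->
   x != y -> z != y -> w != y -> a x y -> col x y <> col z w.
  by move=> *; apply: (distinct_colors_of_free_arc fA) => //; rewrite set0U.
split=> [x y xA yA xy|x y z xA yA zA xy xz yz|x y z w xA yA zA wA xy xz xw yz yw zw].
- by have /orP[/arc_edge//|/arc_edge] := missing_le1_arc (m1 x y xA yA xy); rewrite g_sym.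
- case axy: (a x y); first by apply: key => //; rewrite eq_sym.
  case axz: (a x z); first by apply/nesym; apply: key.
  have pyx : one_way a y x by have := missing_le1_arc (m1 x y xA yA xy); rewrite /one_way axy /= andbT.
  have pzx : one_way a z x by have := missing_le1_arc (m1 x z xA zA xz); rewrite /one_way axz /= andbT.
  by have := ind x y z xA yA zA yz pyx pzx.
have /orP[axy|ayx] := missing_le1_arc (m1 x y xA yA xy).
  by apply: key => //; rewrite eq_sym.
by rewrite colC; apply: key => //; rewrite eq_sym.
Qed.

Lemma rainbow_union (F A : {set T}) :
  (forall y, y \in A -> y \notin determined col a (F :|: A :\ y)) ->
  (forall x y, x \in A -> y \in A -> x != y -> a x y) ->
  rainbow_clique F ->
  (forall f y, f \in F -> y \in A -> a f y) ->
  (forall f f' y, f \in F -> f' \in F -> y \in A -> f != f' -> col y f <> col y f') ->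
  rainbow_clique (F :|: A).
Proof.
move=> fA aA [cF rF1 rF2] aF colF.
have arc x y : x \in F :|: A -> y \in A -> x != y -> a x y.
  by rewrite inE => /orP[xF|xA] yA xy; [apply: aF | apply: aA].
have key x y z w : x \in F :|: A -> y \in A -> z \in F :|: A -> w \in F :|: A ->
   x != y -> z != y -> w != y -> col x y <> col z w.
  by move=> *; apply: (distinct_colors_of_free_arc fA) => //; apply: arc.
have inFA x : x \in F :|: A -> (x \in F) || (x \in A) by rewrite inE.
split=> [x y xS yS xy|x y z xS yS zS xy xz yz|x y z w xS yS zS wS xy xz xw yz yw zw].
- have /orP[yF|yA] := inFA _ yS; last by apply: arc_edge; apply: arc.
  have /orP[xF|xA] := inFA _ xS; first exact: cF.
  by rewrite g_sym; apply: arc_edge; apply: arc; rewrite // eq_sym.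
- have /orP[yF|yA] := inFA _ yS; last by apply: key => //; rewrite eq_sym.
  have /orP[zF|zA] := inFA _ zS; last by apply/nesym; apply: key.
  have /orP[xF|xA] := inFA _ xS; first exact: rF1.
  exact: colF.
- have /orP[yF|yA] := inFA _ yS; last by apply: key => //; rewrite eq_sym.
  have /orP[xF|xA] := inFA _ xS; last by rewrite colC; apply: key => //; rewrite eq_sym.
  have /orP[wF|wA] := inFA _ wS; last by apply/nesym; apply: key.
  have /orP[zF|zA] := inFA _ zS; last by apply/nesym; rewrite (colC z w); apply: key => //; rewrite eq_sym.
  exact: rF2.
Qed.

(** Greedy choice of one vertex from each [Y i] with i in P, bidirected to the
    previous ones and keeping the set free. *)
Lemma rainbow_extension (r D e0 : nat) (F : {set T}) (free : {set {set T}})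
    (Y : 'I_r -> {set T}) (P : {set 'I_r}) :
  set0 \in free ->
  (forall A, A \in free -> #|A| <= r -> #|[set v | (v \notin A) && (v |: A \notin free)]| <= e0) ->
  (forall A, A \in free -> #|A| <= r.+1 -> forall y, y \in A -> y \notin determined col a (F :|: A :\ y)) ->
  rainbow_clique F ->
  (forall i f y, i \in P -> f \in F -> y \in Y i -> a f y) ->
  (forall i f f' y, i \in P -> f \in F -> f' \in F -> y \in Y i -> f != f' -> col y f <> col y f') ->
  (forall i j y, i \in P -> j \in P -> i != j -> y \in Y i ->
     #|[set w in Y j | missing a w y != 0]| <= D) ->
  (forall i, i \in P -> r * D + e0 < #|Y i|) ->
  exists S : {set T}, #|S| = #|F| + #|P| /\ rainbow_clique S.
Proof.
move=> free0 freeX freeD rF aF colF near big.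
have Pr (P' : {set 'I_r}) : #|P'| <= r by rewrite -[X in _ <= X]card_ord max_card.
have [A [fA cA AY A0]] : exists A : {set T}, [/\ A \in free, #|A| = #|P|,
    forall x, x \in A -> exists2 i, i \in P & x \in Y i &
    forall x y, x \in A -> y \in A -> x != y -> missing a x y = 0].
  suff : forall k (P' : {set 'I_r}), #|P'| = k -> P' \subset P -> exists A : {set T}, [/\ A \in free, #|A| = k,
    forall x, x \in A -> exists2 i, i \in P' & x \in Y i &
    forall x y, x \in A -> y \in A -> x != y -> missing a x y = 0].
    by move/(_ _ P erefl (subxx P)).
  elim=> [|k IH] P' cP' sP'.
    by exists set0; split; rewrite ?cards0 // => x; rewrite inE.
  have /card_gt0P[i iP'] : 0 < #|P'| by rewrite cP'.
  have iP := subsetP sP' _ iP'.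
  have cP1 : #|P' :\ i| = k by have := cardsD1 i P'; rewrite iP' cP' add1n => -[].
  have [A [fA cA AY A0]] := IH _ cP1 (subset_trans (subD1set _ _) sP').
  have kr : k < r by rewrite -cP' Pr.
  pose B := \bigcup_(x in A) [set w in Y i | missing a w x != 0].
  pose N := [set v | (v \notin A) && (v |: A \notin free)].
  have cB : #|B| <= r * D.
    apply: leq_trans (card_bigcup_leq (m := D) _) _.
      by move=> x /AY[j]; rewrite in_setD1 => /andP[ji jP'] xj; apply: (near j) => //; exact: (subsetP sP').
    by rewrite cA leq_mul2r (ltnW kr) orbT.
  have cN : #|N| <= e0 by apply: freeX; rewrite // cA ltnW.
  have [v vY vBN] : exists2 v, v \in Y i & v \notin B :|: N.
    apply/exists_inP; apply: contraT; rewrite negb_exists_in => /forall_inP h.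
    have : #|Y i| <= #|B :|: N|.
      by apply: subset_leq_card; apply/subsetP=> v /h; rewrite negbK.
    have := (leq_card_setU B N).1; have := big i iP; move: cB cN; clear; lia.
  move: vBN; rewrite in_setU negb_or => /andP[vB vN].
  have v0 x : x \in A -> missing a v x = 0.
    move=> xA; apply/eqP; apply: contraR vB => m; apply/bigcupP; exists x => //.
    by rewrite inE vY.
  have vA : v \notin A by apply/negP=> /v0; rewrite missingxx //; exact: a_irr.
  exists (v |: A); split.
  - by move: vN; rewrite inE vA negbK.
  - by rewrite cardsU1 vA cA.
  - move=> x; rewrite in_setU1 => /orP[/eqP->|/AY[j]]; first by exists i.
    by rewrite in_setD1 => /andP[_ jP'] xj; exists j.
  - move=> x y; rewrite !in_setU1 => /orP[/eqP->|xA] /orP[/eqP->|yA]; rewrite ?eqxx // => xy.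
    + exact: v0.
    + by rewrite missingC v0.
    + exact: A0.
have FA : [disjoint F & A].
  rewrite disjoint_subset; apply/subsetP=> x xF; rewrite !inE; apply/negP=> /AY[i iP xi].
  by have := aF i x x iP xF xi; rewrite a_irr.
exists (F :|: A); split; first by rewrite cardsU (disjoint_setI0 FA) cards0 subn0 cA.
apply: rainbow_union => //.
- by apply: freeD; rewrite // cA ltnW // ltnS.
- by move=> x y xA yA xy; have /andP[] := missing0_arcs (A0 x y xA yA xy).
- by move=> f y fF /AY[i iP yi]; apply: aF iP fF yi.
- by move=> f f' y fF fF' /AY[i iP yi]; apply: colF iP fF fF' yi.
Qed.
End Colouring.

(** * From an approximate to an exact partition *)

(** The Cauchy-Schwarz inequality with its defect, in which truncated differences
    express the absolute value of x i - x j. *)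
Lemma sum_squares_identity (r : nat) (x : 'I_r -> nat) :
  2 * (r * \sum_i x i ^ 2) =
  2 * (\sum_i x i) ^ 2 + \sum_i \sum_j ((x i - x j) + (x j - x i)) ^ 2.
Proof.
have id i j : x i ^ 2 + x j ^ 2 = 2 * (x i * x j) + ((x i - x j) + (x j - x i)) ^ 2.
  by case: (leqP (x i) (x j)) => h; [rewrite -(subnKC h) | rewrite -(subnKC (ltnW h))]; nia.
have e1 : \sum_i \sum_j (x i ^ 2 + x j ^ 2) = 2 * (r * \sum_i x i ^ 2).
  rewrite (eq_bigr (fun i => r * x i ^ 2 + \sum_j x j ^ 2)); last first.
    by move=> i _; rewrite big_split /= sum_nat_const card_ord.
  by rewrite big_split /= sum_nat_const card_ord -big_distrr /=; lia.
rewrite -e1 (eq_bigr (fun i => 2 * (x i * \sum_j x j) + \sum_j ((x i - x j) + (x j - x i)) ^ 2)); last first.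
  by move=> i _; rewrite (eq_bigr _ (fun j _ => id i j)) big_split /= -!big_distrr.
by rewrite big_split /= -big_distrr -big_distrl /=.
Qed.

Lemma sum_squares_ge (r : nat) (x : 'I_r -> nat) : (\sum_i x i) ^ 2 <= r * \sum_i x i ^ 2.
Proof. by rewrite -(leq_pmul2l (ltn0Sn 1)) sum_squares_identity leq_addr. Qed.

Lemma sum_squares_eq (r : nat) (x : 'I_r -> nat) :
  r * \sum_i x i ^ 2 <= (\sum_i x i) ^ 2 -> forall i j, x i = x j.
Proof.
move=> h i j; have := sum_squares_identity x.
have : 2 * (r * \sum_i x i ^ 2) <= 2 * (\sum_i x i) ^ 2 by rewrite leq_mul2l h orbT.
set S := \sum_i \sum_j _ => h1 h2.
have : S = 0 by move: h1 h2; clear; lia.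
move/eqP; rewrite sum_nat_eq0 => /forall_inP/(_ i isT); rewrite sum_nat_eq0 => /forall_inP/(_ j isT).
by rewrite expn_eq0 andbT => /eqP; lia.
Qed.

(** The hypotheses on V below are the conclusion of [near_partite]. *)
Section Balancing.
Variables (T : finType) (g : rel T) (col : T -> T -> nat) (a : rel T) (r n D : nat).
Hypothesis g_irr : irreflexive g.
Hypothesis g_sym : symmetric g.
Hypothesis colC : forall x y, col x y = col y x.
Hypothesis arc_edge : forall x y, a x y -> g x y.
Hypothesis rep : representative col a.
Hypothesis cardT : #|T| = n.
Hypothesis r_gt0 : 0 < r.
Hypothesis no_rainbow : forall S : {set T}, #|S| = r.+1 -> ~ rainbow_clique g col S.
Hypothesis out_missing_bound : forall x, r * out_missing a x <= n.
Hypothesis free_ex : forall F : {set T}, #|F| <= 2 -> exists free : {set {set T}},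
  [/\ set0 \in free,
      forall A, A \in free -> #|A| <= r -> #|[set v | (v \notin A) && (v |: A \notin free)]| <= D &
      forall A, A \in free -> #|A| <= r.+1 -> forall y, y \in A -> y \notin determined col a (F :|: A :\ y)].
Variable V : 'I_r -> {set T}.
Hypothesis V_disj : forall i j v, v \in V i -> v \in V j -> i = j.
Hypothesis V_cover : n <= #|\bigcup_i V i| + D.
Hypothesis V_large : forall i, n <= r * (#|V i| + D).
Hypothesis V_near : forall i v, v \in V i ->
  #|[set w | [exists j, (w \in V j) && (missing a w v != if j == i then 2 else 0)]]| <= D.
Hypothesis D_gt0 : 0 < D.
Hypothesis D_small : r * (6 * r + 20) * D <= n.

Lemma part_large i : (6 * r + 19) * D <= #|V i|.
Proof.
have := leq_trans D_small (V_large i); rewrite -mulnA leq_pmul2l //.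
by clear; set m := #|_|; lia.
Qed.

Lemma part_near i j v : v \in V i -> i != j -> #|[set w in V j | missing a w v != 0]| <= D.
Proof.
move=> vi ij; apply: leq_trans (V_near vi); apply: subset_leq_card; apply/subsetP=> w.
rewrite !inE => /andP[wj m]; apply/existsP; exists j; by rewrite wj [j == i]eq_sym (negPf ij) m.
Qed.

Lemma some_part_small (F : {set T}) (Y : 'I_r -> {set T}) (P : {set 'I_r}) :
  #|F| <= 2 -> #|F| + #|P| = r.+1 -> rainbow_clique g col F ->
  (forall i, Y i \subset V i) ->
  (forall i f y, i \in P -> f \in F -> y \in Y i -> a f y) ->
  (forall i f f' y, i \in P -> f \in F -> f' \in F -> y \in Y i -> f != f' -> col y f <> col y f') ->
  exists2 i, i \in P & #|Y i| <= (r + 1) * D.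
Proof.
move=> F2 FP rF sY aF colF; apply/exists_inP; apply: contraT.
rewrite negb_exists_in => /forall_inP h; have [free [f0 fX fD]] := free_ex F2.
have [|i iP|S [cS rS]] := rainbow_extension g_irr g_sym colC arc_edge f0 fX fD rF aF colF (D := D).
- move=> i j y iP jP ij yi; apply: leq_trans (part_near (subsetP (sY i) _ yi) ij).
  apply: subset_leq_card; apply/subsetP=> w; rewrite !inE => /andP[wj ->].
  by rewrite (subsetP (sY j)).
- by have := h i iP; rewrite -ltnNge mulnDl mul1n.
by have := no_rainbow (etrans cS FP) rS.
Qed.

(** Otherwise v and one out-neighbour in each part would give a rainbow clique. *)
Lemma few_out_neighbours_in_a_part v : exists i, #|[set w in V i | a v w]| <= (r + 1) * D.
Proof.
have [||||||i _ h] := @some_part_small [set v] (fun i => [set w in V i | a v w]) setT; last by exists i.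
- by rewrite cards1.
- by rewrite cards1 cardsT card_ord.
- split=> [x y|x y z|x y z w]; rewrite !inE => /eqP-> /eqP->; by rewrite ?eqxx.
- by move=> i; apply/subsetP=> w; rewrite inE => /andP[].
- by move=> i f y _; rewrite !inE => /eqP-> /andP[].
- by move=> i f f' y _; rewrite !inE => /eqP-> /eqP->; rewrite eqxx.
Qed.

(** The parts [W i] collect all vertices with few out-neighbours in [V i]. An
    edge uv inside a part is seen in one colour by many outside
    vertices w (the set [Bd u v]), as otherwise it extends to a rainbow
    clique; each such w misses an arc between the parts. With I arcs inside and M
    missing arcs between the parts, this contradicts M <= I unless I = 0. *)
Lemma partite_of_near_partite : exists f : T -> 'I_r,
  [/\ forall i, r * #|[set x | f x == i]| = n,
      forall x y, g x y = (f x != f y) &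
      forall x y, g x y -> a x y].
Proof.
have [f fP] := fin_all_exists few_out_neighbours_in_a_part.
pose W i := [set x | f x == i].
have VW i : V i \subset W i.
  apply/subsetP=> v vi; rewrite inE; apply: contraT; rewrite eq_sym => ij.
  have c1 := part_near vi ij.
  have : #|V (f v)| <= D + (r + 1) * D.
    rewrite -(cardsID [set w in V (f v) | missing a w v != 0] (V (f v))).
    apply: leq_add.
      by apply: leq_trans c1; apply: subset_leq_card; apply: subsetIr.
    apply: leq_trans (fP v); apply: subset_leq_card; apply/subsetP=> w; rewrite !inE.
    case: (w \in V _); rewrite ?andbF ?andbT //= negbK => /eqP m0.
    by have /andP[] := missing0_arcs m0.
  by have := part_large (f v); move: D_gt0; clear; lia.
have WV i : #|W i :\: V i| <= D.
  have sub : W i :\: V i \subset ~: \bigcup_j V j.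
    apply/subsetP=> v; rewrite !inE => /andP[vV /eqP fv]; apply/bigcupP=> -[j _ vj].
    by have := subsetP (VW j) _ vj; rewrite inE fv => /eqP e; rewrite e vj in vV.
  have := subset_leq_card sub; have := cardsC (\bigcup_j V j); rewrite cardT.
  by move: V_cover; clear; lia.
have in_out v : #|[set w in W (f v) | a v w]| <= (r + 2) * D.
  rewrite -(cardsID (V (f v))).
  have -> : (r + 2) * D = (r + 1) * D + D by lia.
  apply: leq_add.
    apply: leq_trans (fP v); apply: subset_leq_card; apply/subsetP=> w; rewrite !inE.
    by move=> /andP[/andP[_ ->] ->].
  apply: leq_trans (WV (f v)); apply: subset_leq_card; apply/subsetP=> w; rewrite !inE.
  by move=> /andP[-> /andP[->]].
have out_other u j : f u != j -> #|[set w in V j | ~~ a u w]| <= (r + 2) * D.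
  move=> uj.
  have h1 : #|[set w in V j | ~~ a u w]| + #|V (f u) :\: [set w in V (f u) | a u w]| <= out_missing a u.
    have dj : #|[set w in V j | ~~ a u w] :&: (V (f u) :\: [set w in V (f u) | a u w])| = 0.
      apply: eq_card0 => w; rewrite !inE; apply/negP=> /andP[/andP[wj _] /andP[_ wu]].
      by rewrite (V_disj wu wj) eqxx in uj.
    have := cardsUI [set w in V j | ~~ a u w] (V (f u) :\: [set w in V (f u) | a u w]); rewrite dj addn0 => <-.
    apply: subset_leq_card; apply/subsetP=> w; rewrite !inE => /orP[/andP[]//|].
    by case: (w \in V _); rewrite ?andbF ?andbT.
  have h2 := cardsID [set w in V (f u) | a u w] (V (f u)).
  have h3 : #|V (f u) :&: [set w in V (f u) | a u w]| <= (r + 1) * D.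
    by apply: leq_trans (fP u); apply: subset_leq_card; apply: subsetIr.
  have h4 : out_missing a u <= #|V (f u)| + D.
    by rewrite -(leq_pmul2l r_gt0); apply: leq_trans (V_large _).
  by move: h1 h2 h3 h4; clear; lia.
pose Bd u v := [set w | (f w != f u) && (col w u == col w v)].
have inside u v : g u v -> f u = f v -> (r + 2) * D + 2 <= #|Bd u v|.
  move=> guv fuv.
  have uv : u != v by apply: contraTneq guv => ->; rewrite g_irr.
  pose Y j := [set w in V j | [&& a u w, a v w & col w u != col w v]].
  have [||||||j jP Yj] := @some_part_small [set u; v] Y [set~ f u].
  - by rewrite cards2 uv.
  - by rewrite cards2 uv cardsC1 card_ord; move: r_gt0; clear; lia.
  - split=> [x y|x y z|x y z w]; rewrite !inE.
    + by move=> /orP[]/eqP-> /orP[]/eqP->; rewrite ?eqxx // g_sym.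
    + by move=> /orP[]/eqP-> /orP[]/eqP-> /orP[]/eqP->; rewrite ?eqxx.
    + by move=> /orP[]/eqP-> /orP[]/eqP-> /orP[]/eqP->; rewrite ?eqxx.
  - by move=> i; apply/subsetP=> w; rewrite inE => /andP[].
  - by move=> i x y _; rewrite !inE => /orP[]/eqP-> /and4P[].
  - move=> i x x' y _; rewrite !inE => /orP[]/eqP-> /orP[]/eqP-> /and4P[_ _ _ /eqP c] //; rewrite ?eqxx //.
    by move=> _ /esym.
  rewrite !inE in jP.
  have sub : V j \subset (Y j :|: Bd u v) :|: ([set w in V j | ~~ a u w] :|: [set w in V j | ~~ a v w]).
    apply/subsetP=> w wj; have := subsetP (VW j) _ wj; rewrite !inE wj => /eqP->.
    by rewrite jP; case: (a u w); case: (a v w); case: (_ == _).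
  have := subset_leq_card sub.
  have := (leq_card_setU (Y j :|: Bd u v) ([set w in V j | ~~ a u w] :|: [set w in V j | ~~ a v w])).1.
  have := (leq_card_setU (Y j) (Bd u v)).1.
  have := (leq_card_setU [set w in V j | ~~ a u w] [set w in V j | ~~ a v w]).1.
  have fuj : f u != j by rewrite eq_sym.
  have := out_other u j fuj; rewrite fuv in fuj; have := out_other v j fuj.
  have := part_large j; have : D <= r * D by rewrite leq_pmull.
  by move: Yj D_gt0; clear; lia.
pose m w x : bool := (f w != f x) && ~~ a w x.
pose i u v : bool := (f u == f v) && a u v.
pose M := \sum_w \sum_x (m w x : nat); pose I := \sum_u \sum_v (i u v : nat).
(* For each w, the missing out-arcs together with the inside arcs make up the part of
   w together with the missing arcs between parts; sum over w. *)
have MI : r * (\sum_j #|W j| ^ 2) + r * M <= n ^ 2 + r * I.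
  have e1 w : out_missing a w + \sum_v (i w v : nat) = #|W (f w)| + \sum_x (m w x : nat).
    rewrite /out_missing -!sum1_card !(big_mkcond (fun x => x \in [set _ | _])) -!big_split /=.
    apply: eq_bigr => x _; rewrite !inE /i /m [f x == f w]eq_sym.
    by case: (f w == f x); case: (a w x).
  have e2 : \sum_w #|W (f w)| = \sum_j #|W j| ^ 2.
    rewrite (partition_big f xpredT) //=; apply: eq_bigr => j _.
    rewrite (eq_bigr (fun _ => #|W j|)); last by move=> w /eqP->.
    by rewrite sum_nat_const -mulnn; congr (_ * _); apply: eq_card => w; rewrite !inE.
  have e3 : \sum_w out_missing a w + I = \sum_j #|W j| ^ 2 + M.
    by rewrite -e2 -!big_split /=; apply: eq_bigr.
  have e4 : r * \sum_w out_missing a w <= n ^ 2.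
    rewrite big_distrr /= -mulnn -{1}cardT -sum_nat_const; exact: leq_sum.
  have e5 : r * (\sum_w out_missing a w + I) = r * (\sum_j #|W j| ^ 2 + M) by rewrite e3.
  by move: e4 e5; rewrite !mulnDr; clear; lia.
have sW : \sum_j #|W j| = n.
  rewrite -cardT -sum1_card (partition_big f xpredT) //=; apply: eq_bigr => j _.
  by rewrite -sum1_card; apply: eq_bigl => x; rewrite !inE.
have M_le_I : M <= I.
  rewrite -(leq_pmul2l r_gt0); have := sum_squares_ge (fun j => #|W j|); rewrite sW.
  by move: MI; clear; set s := \sum_j _; lia.
(* A missing arc from w to u is blamed at most (r + 2) D times as the tail of
   an inside arc, and a missing arc from w to v at most once as the head: the tail is
   then the vertex kept by w for its colour. *)
have count : I * ((r + 2) * D + 2) <= M * ((r + 2) * D + 1).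
  have e1 : I * ((r + 2) * D + 2) <= \sum_u \sum_v \sum_w i u v * (m w u + m w v * (a w u && (col w u == col w v))).
    rewrite big_distrl; apply: leq_sum => u _; rewrite big_distrl; apply: leq_sum => v _ /=.
    rewrite -big_distrr /=; case iuv: (i u v) => //; rewrite !mul1n.
    have /andP[/eqP fuv auv] := iuv.
    apply: leq_trans (inside u v (arc_edge auv) fuv) _.
    rewrite -sum1_card big_mkcond; apply: leq_sum => w _; rewrite inE /m -fuv.
    case: (f w != f u) => //=; case c: (col w u == col w v) => //.
    case awu: (a w u) => //=; case awv: (a w v) => //=.
    by have := rep awu awv (eqP c) => uv; rewrite uv in auv; have := arc_edge auv; rewrite g_irr.
  apply: (leq_trans e1).
  have e2 : \sum_u \sum_v \sum_w i u v * (m w u + m w v * (a w u && (col w u == col w v))) <=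
     \sum_u \sum_w m w u * \sum_v i u v + \sum_v \sum_w m w v * \sum_u (a w u && (col w u == col w v)).
    have -> : \sum_u \sum_w m w u * \sum_v i u v = \sum_u \sum_v \sum_w m w u * i u v.
      by apply: eq_bigr => u _; rewrite exchange_big /=; apply: eq_bigr => w _; rewrite big_distrr.
    have -> : \sum_v \sum_w m w v * \sum_u (a w u && (col w u == col w v)) =
        \sum_u \sum_v \sum_w m w v * (a w u && (col w u == col w v)).
      rewrite [RHS]exchange_big /=; apply: eq_bigr => v _; rewrite [RHS]exchange_big /=.
      by apply: eq_bigr => w _; rewrite big_distrr.
    rewrite -big_split; apply: leq_sum => u _; rewrite -big_split; apply: leq_sum => v _.
    rewrite -big_split; apply: leq_sum => w _ /=.
    by rewrite mulnDr mulnC leq_add2l; case: (i u v); rewrite ?mul1n.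
  apply: (leq_trans e2); rewrite mulnDr muln1; apply: leq_add.
    rewrite /M [X in _ <= X * _]exchange_big /= big_distrl; apply: leq_sum => u _.
    rewrite big_distrl; apply: leq_sum => w _; rewrite leq_mul2l; apply/orP; right.
    apply: leq_trans (in_out u); rewrite -sum1_card [leqRHS]big_mkcond; apply: leq_sum => v _.
    by rewrite !inE /i eq_sym; case: (_ && _).
  rewrite /M [leqRHS]exchange_big /=; apply: leq_sum => v _; apply: leq_sum => w _.
  rewrite -[leqRHS]muln1 leq_mul2l; apply/orP; right.
  have -> : \sum_u (a w u && (col w u == col w v) : nat) = #|[set u | a w u && (col w u == col w v)]|.
    by rewrite -sum1_card [RHS]big_mkcond; apply: eq_bigr => u _; rewrite inE; case: (_ && _).
  apply/card_le1_eqP => x y; rewrite !inE => /andP[ax /eqP cx] /andP[ay /eqP cy].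
  by apply: (rep ay ax); rewrite cx cy.
have I0 : I = 0.
  have : I * ((r + 2) * D + 2) <= I * ((r + 2) * D + 1).
    by apply: (leq_trans count); rewrite leq_mul2r M_le_I orbT.
  by rewrite !mulnDr; clear; lia.
have M0 : M = 0 by apply/eqP; rewrite -leqn0 -I0.
have arc x y : f x != f y -> a x y.
  move=> fxy; apply: contraT => axy; move/eqP: M0.
  rewrite sum_nat_eq0 => /forall_inP/(_ x isT); rewrite sum_nat_eq0 => /forall_inP/(_ y isT).
  by rewrite /m fxy axy.
have gf x y : g x y = (f x != f y).
  apply/idP/idP => [gxy|/arc/arc_edge//]; apply/eqP=> fxy.
  have /card_gt0P[w] : 0 < #|Bd x y| by apply: leq_trans (inside x y gxy fxy); rewrite addn2.
  rewrite inE => /andP[fw /eqP c].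
  have xy := rep (arc _ _ fw) (arc w y _) c; rewrite -fxy fw in xy.
  by have := g_irr x; rewrite {2}(xy isT) gxy.
exists f; split=> //; last by move=> x y; rewrite gf => /arc.
move=> j; have eq : forall j', #|W j'| = #|W j|.
  move=> j'; apply: (@sum_squares_eq _ (fun j => #|W j|)).
  by rewrite sW; move: MI; rewrite I0 M0 !muln0 !addn0.
by rewrite -[RHS]sW (eq_bigr _ (fun j' _ => eq j')) sum_nat_const card_ord.
Qed.
End Balancing.

Lemma partite_of_no_rainbow_clique (r : nat) : 0 < r -> exists n0,
  forall (T : finType) (g : rel T) (col : T -> T -> nat) (a : rel T),
  n0 <= #|T| -> irreflexive g -> symmetric g -> (forall x y, col x y = col y x) ->
  (forall x y, a x y -> g x y) -> representative col a ->
  (forall S : {set T}, #|S| = r.+1 -> ~ rainbow_clique g col S) ->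
  (forall x, r * out_missing a x <= #|T|) ->
  exists f : T -> 'I_r,
  [/\ forall i, r * #|[set x | f x == i]| = #|T|,
      forall x y, g x y = (f x != f y) &
      forall x y, g x y -> a x y].
Proof.
move=> r0; pose t := r * (6 * r + 20).
have t0 : 0 < t by rewrite muln_gt0 r0 addn_gt0 orbT.
have [n1 [L Hn1]] := near_partite t r0.
have [n2 Hn2] := free_system r (L + t).
exists (n1 + n2) => T g col a nT girr gsym colC arc_edge rep nr out_missing_bound.
have n1T : n1 <= #|T| by apply: leq_trans nT; rewrite leq_addr.
have n2T : n2 <= #|T| by apply: leq_trans nT; rewrite leq_addl.
have F0 : #|(set0 : {set T})| <= 2 by rewrite cards0.
have [free [f0 fS fX fD]] := Hn2 T col a set0 n2T F0 rep.
have airr := a_irr girr arc_edge.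
have [A fA Ar|S fS' cS adm|V [D [D0 [tD [disj cov big near]]]]] :=
    Hn1 T a free #|T| erefl n1T airr f0 fS _ _ out_missing_bound.
- by apply: leq_trans (fX A fA Ar); rewrite leq_mul2r leq_addr orbT.
- apply: (nr S cS); apply: (rainbow_admissible gsym colC arc_edge _ adm).
  by apply: fD; rewrite // cS.
(* The free sets for other F are controlled only up to #|T| / t, so the error is
   raised to that value. *)
pose D' := maxn D (#|T| %/ t).
have DD' : D <= D' by apply: leq_maxl.
apply: (@partite_of_near_partite T g col a r #|T| D' girr gsym colC arc_edge rep erefl r0 nr out_missing_bound _ V disj).
- move=> F F2; have [free' [f0' fS' fX' fD']] := Hn2 T col a F n2T F2 rep.
  exists free'; split=> // A fA Ar; apply: leq_trans (leq_maxr _ _); rewrite leq_divRL // mulnC.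
  by apply: leq_trans (fX' A fA Ar); rewrite leq_mul2r leq_addl orbT.
- by apply: leq_trans cov _; rewrite leq_add2l.
- by move=> i; apply: leq_trans (big i) _; rewrite leq_mul2l leq_add2l DD' orbT.
- by move=> i v vi; apply: leq_trans (near i v vi) DD'.
- exact: leq_trans D0 DD'.
by rewrite -/t maxnMr geq_max tD mulnC leq_divM.
Qed.

(** * The digraph of an edge-coloured graph *)
Section FromColouring.
Variables (T : finType) (G : sgraph T) (c : coloring G).

(** The value 0 on non-edges is a default; it can only enlarge the sets
    [determined]. *)
Definition pair_color (x y : T) : nat :=
  if insub [set x; y] is Some e then c e else 0.

(** [pick] depends only on the extension of its predicate, so that all edges at x of
    one colour select the same y. *)
Definition rep_arc (x y : T) : bool :=
  G x y && ([pick z | G x z && (pair_color x z == pair_color x y)] == Some y).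

Lemma pair_colorC x y : pair_color x y = pair_color y x.
Proof. by rewrite /pair_color setUC. Qed.

Lemma pair_color_val (e : edge G) x y : val e = [set x; y] -> pair_color x y = c e.
Proof. by move=> E; rewrite /pair_color -E valK. Qed.

Lemma edge_ends (e : edge G) v : v \in val e -> exists2 y, G v y & val e = [set v; y].
Proof.
have /imsetP[[x y]] := valP e; rewrite inE /= => gxy ->.
rewrite !inE => /orP[]/eqP->; first by exists y.
by exists x; [rewrite adj_sym | rewrite setUC].
Qed.

Lemma rep_arc_exists x y : G x y -> exists2 z, rep_arc x z & pair_color x z = pair_color x y.
Proof.
move=> gxy; case E: [pick z | G x z && (pair_color x z == pair_color x y)] => [z|].
  have /andP[gxz /eqP e] : G x z && (pair_color x z == pair_color x y).
    by move: E; case: pickP => // z' h [<-].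
  by exists z; rewrite // /rep_arc gxz e E eqxx.
by move: E; case: pickP => // /(_ y); rewrite gxy eqxx.
Qed.

Lemma rep_arc_representative : representative pair_color rep_arc.
Proof.
move=> x y z /andP[_ /eqP ey] /andP[_ /eqP ez] e; rewrite e ez in ey.
by case: ey.
Qed.

Lemma color_degree_le v : color_degree c v <= #|[set y | rep_arc v y]|.
Proof.
have <- : size [seq pair_color v y | y in [set y | rep_arc v y]] = #|[set y | rep_arc v y]|.
  by rewrite size_image.
apply: uniq_leq_size (undup_uniq _) _ => k; rewrite mem_undup => /imageP[e].
rewrite inE => ve ->; have [y gvy E] := edge_ends ve.
have [z az ez] := rep_arc_exists gvy; apply/imageP; exists z; rewrite ?inE //.
by rewrite ez (pair_color_val E).
Qed.

Lemma min_color_degree_le v : min_color_degree c <= color_degree c v.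
Proof.
rewrite /min_color_degree; have : v \in index_enum T by rewrite mem_index_enum.
elim: (index_enum T) => // x s IH; rewrite inE big_cons => /orP[/eqP<-|/IH h]; first exact: geq_minl.
by apply: leq_trans (geq_minr _ _) h.
Qed.

Lemma has_rainbow_clique_of (S : {set T}) : rainbow_clique G pair_color S -> has_rainbow_clique c #|S|.
Proof.
move=> [cl r1 r2]; exists S; split=> //.
move=> e f; rewrite !inE => eS fS cef; apply: val_inj.
have [x xe] : exists x, x \in val e.
  have /imsetP[[x y] _ ->] := valP e; by exists x; rewrite !inE eqxx.
have [y gxy E] := edge_ends xe.
have [z zf] : exists z, z \in val f.
  have /imsetP[[z w] _ ->] := valP f; by exists z; rewrite !inE eqxx.
have [w gzw F] := edge_ends zf.
have neq u v : G u v -> u != v by apply: contraTneq => ->; rewrite adj_irrefl.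
have yS : y \in S by apply: (subsetP eS); rewrite E !inE eqxx orbT.
have xS := subsetP eS _ xe; have zS := subsetP fS _ zf.
have wS : w \in S by apply: (subsetP fS); rewrite F !inE eqxx orbT.
have ccc : pair_color x y = pair_color z w by rewrite (pair_color_val E) (pair_color_val F).
have xy := neq _ _ gxy; have zw := neq _ _ gzw.
rewrite E F.
have [xz|xz] := eqVneq x z.
  subst z; have [->//|yw] := eqVneq y w.
  by case: (r1 x y w).
have [xw|xw] := eqVneq x w.
  subst w; have [->|yz] := eqVneq y z; first by rewrite setUC.
  by case: (r1 x y z) => //; rewrite ccc pair_colorC.
have [yz|yz] := eqVneq y z.
  subst z; case: (r1 y x w) => //; by rewrite // 1?eq_sym // pair_colorC.
have [yw|yw] := eqVneq y w.
  by subst w; case: (r1 y x z) => //; rewrite 1?eq_sym // pair_colorC ccc pair_colorC.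
by case: (r2 x y z w).
Qed.
End FromColouring.

Theorem theorem1p2 :
  forall s : nat, 2 <= s ->
  exists n0 : nat, forall n : nat, n0 <= n ->
  forall (T : finType) (G : sgraph T) (c : coloring G),
    #|T| = n ->
    ((1 - 1 / (s%:R - 1)) * n%:R <= (min_color_degree c)%:R :> rat)%R ->
    ~ has_rainbow_clique c s ->
    [/\ (s - 1 %| n)%N,
        complete_balanced_partite G (s - 1)
      & proper_coloring c].
Proof.
case=> [|r] //; rewrite ltnS => r0; rewrite subn1 /=.
have [n0 Hn0] := partite_of_no_rainbow_clique r0.
exists n0 => n nn T G c cT deg norb.
have degn : r * n <= r * min_color_degree c + n.
  have rR : (0 < r%:R :> rat)%R by rewrite ltr0n.
  move: deg; rewrite -(ler_pM2l rR) -addn1 natrD addrK => h.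
  rewrite -(ler_nat rat) natrD !natrM; move: h.
  have -> : (r%:R * ((1 - 1 / r%:R) * n%:R) = r%:R * n%:R - n%:R :> rat)%R.
    by field; rewrite lt0r_neq0.
  by rewrite lerBlDr.
have out_missing_bound x : r * out_missing (rep_arc c) x <= #|T|.
  have := cardsC [set y | rep_arc c x y].
  have -> : #|~: [set y | rep_arc c x y]| = out_missing (rep_arc c) x.
    by apply: eq_card => y; rewrite !inE.
  have := leq_trans (min_color_degree_le c x) (color_degree_le c x).
  rewrite -(leq_pmul2l r0) cT => h1 h2.
  have : r * n = r * #|[set y | rep_arc c x y]| + r * out_missing (rep_arc c) x by rewrite -mulnDr h2.
  by move: h1 degn; clear; lia.
have arcG x y : rep_arc c x y -> G x y by case/andP.
have noclique (S : {set T}) : #|S| = r.+1 -> ~ rainbow_clique G (pair_color c) S.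
  by move=> cS /has_rainbow_clique_of; rewrite cS.
have n0T : n0 <= #|T| by rewrite cT.
have [f [fn gf ga]] := Hn0 T G (pair_color c) (rep_arc c) n0T (@adj_irrefl _ G)
  (@adj_sym _ G) (pair_colorC c) arcG (rep_arc_representative (c := c)) noclique out_missing_bound.
rewrite cT in fn; split.
- by rewrite -(fn (Ordinal r0)) dvdn_mulr.
- by exists f; split=> // i; rewrite cT -(fn i) mulKn.
move=> v e e' ve ve'; apply: contraNneq => cee; apply/eqP/val_inj.
have [y gvy E] := edge_ends ve; have [z gvz E'] := edge_ends ve'.
rewrite E E' (rep_arc_representative (ga _ _ gvy) (ga _ _ gvz)) //.
by rewrite (pair_color_val c E) (pair_color_val c E').
Qed.
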